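(* Let $Q$ be a strongly locally finite quiver, $k$ a field, and let $M$ be a $k$-representation of $Q$ (an object of $\mathrm{Rep}(Q)$). (1) $M$ is almost finitely presented if and only if $M$ is projective restricted to some co-finite successor-closed subquiver of $\mathrm{supp}\,M$. (2) $M$ is almost finitely co-presented if and only if $M$ is injective restricted to some co-finite predecessor-closed subquiver of $\mathrm{supp}\,M$.
   Context: A quiver $Q=(Q_0,Q_1)$ (vertices $Q_0$, arrows $Q_1$) is locally finite if every vertex is the starting point of finitely many arrows and the ending point of finitely many arrows; interval-finite if for all $x,y\in Q_0$ the set $Q(x,y)$ of paths from $x$ to $y$ (including the trivial path $\varepsilon_x$ if $x=y$) is finite; strongly locally finite if it is both. $\mathrm{Rep}(Q)$ is the category of all $k$-representations of $Q$; tensor products are over $k$. For $a\in Q_0$: $P_a$ is the representation with $P_a(x)$ the $k$-space with basis $Q(a,x)$, an arrow $\alpha:x\to y$ acting by $\rho\mapsto\alpha\rho$. $I_a$ is the representation with $I_a(x)$ the $k$-space with basis $Q(x,a)$, where for an arrow $\alpha:x\to y$ the map $I_a(\alpha)$ sends $\rho\alpha$ to $\rho$ and vanishes on paths not factoring through $\alpha$. $\mathrm{Proj}(Q)$ (respectively $\mathrm{Inj}(Q)$) is the full additive subcategory of $\mathrm{Rep}(Q)$ generated by the objects isomorphic to $P_a\otimes U$ (respectively $I_a\otimes U$) with $a\in Q_0$ and $U$ an arbitrary $k$-space; so its objects are isomorphic to finite direct sums of such objects. $M$ is almost finitely presented if there is an exact sequence $0\to P_1\to P_0\to M\to 0$ with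 $P_0,P_1\in\mathrm{Proj}(Q)$; $M$ is almost finitely co-presented if there is an exact sequence $0\to M\to I_0\to I_1\to 0$ with $I_0,I_1\in\mathrm{Inj}(Q)$. $\mathrm{supp}\,M$ is the full subquiver of $Q$ generated by the vertices $x$ with $M(x)\neq0$. A subquiver $\Sigma$ of a quiver $\Delta$ is successor-closed (predecessor-closed) in $\Delta$ if every path in $\Delta$ starting (ending) at a vertex of $\Sigma$ lies entirely in $\Sigma$; a full subquiver $\Sigma$ is co-finite in $\Delta$ if only finitely many vertices of $\Delta$ are not in $\Sigma$. The restriction $M_\Sigma\in\mathrm{Rep}(Q)$ of $M$ to a subquiver $\Sigma$ of $Q$ agrees with $M$ on the vertices and arrows of $\Sigma$ and is $0$ on all other vertices and arrows. For a full subquiver $\Sigma$ of $Q$, $M$ is projective (injective) restricted to $\Sigma$ if $M_\Sigma\in\mathrm{Proj}(Q)$ ($M_\Sigma\in\mathrm{Inj}(Q)$). *)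

(* Defs.v *)
From HB Require Import structures.
From mathcomp Require Import all_boot all_algebra ring_quotient finmap.
From mathcomp Require Import monalg.
From mathcomp Require Import boolp classical_sets cardinality.
From Stdlib Require Eqdep_dec.

Set Implicit Arguments.
Unset Strict Implicit.
Unset Printing Implicit Defensive.

Import GRing.Theory.

Local Open Scope classical_set_scope.
Local Open Scope quotient_scope.
Local Open Scope ring_scope.

Record quiver := Quiver {
  vertex :> Type;
  arrow : vertex -> vertex -> Type
}.

(* [pcons alpha p] is the path that runs through [alpha] first and then through
   [p]; in the right-to-left notation for composition it is [p alpha]. *)
Inductive qpath (Q : quiver) : Q -> Q -> Type :=
| pnil x : qpath x x
| pcons x y z : arrow x y -> qpath y z -> qpath x z.

Arguments pnil {Q} x.

(* the path [alpha p] in the right-to-left notation *)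
Fixpoint prcons (Q : quiver) (x y z : Q) (p : qpath x y) :
    arrow y z -> qpath x z :=
  match p in qpath x y return arrow y z -> qpath x z with
  | pnil _ => fun alpha => pcons alpha (pnil _)
  | pcons _ _ _ beta p' => fun alpha => pcons beta (prcons p' alpha)
  end.

Lemma pcons_inj (Q : quiver) (x y z : Q) (alpha : arrow x y) :
  injective (@pcons Q x y z alpha).
Proof.
have dec (T : Type) (u v : T) : {u = v} + {u <> v}.
  by case: (pselect (u = v)); [left | right].
move=> p q e; injection e as e'.
have := Eqdep_dec.inj_pair2_eq_dec _ (dec _) _ _ _ _ e'.
exact: Eqdep_dec.inj_pair2_eq_dec (dec _) _ _ _ _.
Qed.

Definition locally_finite (Q : quiver) : Prop :=
  forall x : Q,
    finite_set [set: {y : Q & arrow x y}] /\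
    finite_set [set: {y : Q & arrow y x}].

Definition interval_finite (Q : quiver) : Prop :=
  forall x y : Q, finite_set [set: qpath x y].

Definition strongly_locally_finite (Q : quiver) : Prop :=
  locally_finite Q /\ interval_finite Q.

Record subquiver (Q : quiver) := Subquiver {
  sub_vertex : set Q;
  sub_arrow : forall x y : Q, set (arrow x y);
  sub_arrow_ends : forall (x y : Q) (alpha : arrow x y),
    sub_arrow alpha -> sub_vertex x /\ sub_vertex y
}.

Lemma full_arrow_ends (Q : quiver) (A : set Q) (x y : Q) (alpha : arrow x y) :
  [set _ : arrow x y | A x /\ A y] alpha -> A x /\ A y.
Proof. by []. Qed.

Definition full_on (Q : quiver) (A : set Q) : subquiver Q :=
  @Subquiver Q A (fun x y => [set _ : arrow x y | A x /\ A y])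
    (@full_arrow_ends Q A).

Section Subquivers.
Variable Q : quiver.
Implicit Types (S D : subquiver Q).

Definition is_subquiver S D : Prop :=
  sub_vertex S `<=` sub_vertex D /\
  forall (x y : Q) (alpha : arrow x y), sub_arrow S alpha -> sub_arrow D alpha.

Definition is_full S D : Prop :=
  forall (x y : Q) (alpha : arrow x y),
    sub_vertex S x -> sub_vertex S y -> sub_arrow D alpha -> sub_arrow S alpha.

Fixpoint path_in S (x y : Q) (p : qpath x y) : Prop :=
  match p with
  | pnil z => sub_vertex S z
  | pcons _ _ _ alpha p' => sub_arrow S alpha /\ path_in S p'
  end.

Definition successor_closed S D : Prop :=
  forall (x y : Q) (p : qpath x y),
    path_in D p -> sub_vertex S x -> path_in S p.

Definition predecessor_closed S D : Prop :=
  forall (x y : Q) (p : qpath x y),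
    path_in D p -> sub_vertex S y -> path_in S p.

Definition cofinite S D : Prop :=
  is_full S D /\ finite_set (sub_vertex D `\` sub_vertex S).

End Subquivers.

(* [{malg k[K]}] is the [k]-space with basis [K], the basis vector of [b : K]
   being [<< b >>]. *)
Section LinearExtension.
Variables (k : fieldType) (K : choiceType) (V : lmodType k) (h : K -> V).

Definition lin_ext (g : {malg k[K]}) : V := \sum_(b <- msupp g) g@_b *: h b.

Lemma lin_extEw (d : {fset K}) (g : {malg k[K]}) :
  (msupp g `<=` d)%fset -> lin_ext g = \sum_(b <- d) g@_b *: h b.
Proof.
move=> le; rewrite [LHS](big_fset_incl _ le) => //= x xd /mcoeff_outdom ->.
by rewrite scale0r.
Qed.

Lemma lin_extU (b : K) : lin_ext << b >> = h b.
Proof. by rewrite (lin_extEw msuppU_le) big_seq_fset1 mcoeffUU scale1r. Qed.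

Lemma lin_ext_is_linear : linear lin_ext.
Proof.
move=> a g1 g2; pose E := (msupp (a *: g1 + g2) `|` (msupp g1 `|` msupp g2))%fset.
have sub1 : (msupp (a *: g1 + g2) `<=` E)%fset by exact: fsubsetUl.
have sub2 : (msupp g1 `<=` E)%fset.
  by apply: fsubset_trans (fsubsetUr _ _); exact: fsubsetUl.
have sub3 : (msupp g2 `<=` E)%fset.
  by apply: fsubset_trans (fsubsetUr _ _); exact: fsubsetUr.
rewrite (lin_extEw sub1) (lin_extEw sub2) (lin_extEw sub3).
rewrite scaler_sumr -big_split; apply: eq_bigr => b _ /=.
by rewrite mcoeffD mcoeffZ scalerDl scalerA.
Qed.

HB.instance Definition _ :=
  GRing.isLinear.Build k {malg k[K]} V *:%R lin_ext lin_ext_is_linear.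

End LinearExtension.

Section TensorDef.
Variables (k : fieldType) (V W : lmodType k).

Inductive tensor_rel : {malg k[(V * W)%type]} -> Prop :=
| tensor_rel0 : tensor_rel 0
| tensor_rel_lin a r s :
    tensor_rel r -> tensor_rel s -> tensor_rel (a *: r + s)
| tensor_rel_left a v v' w :
    tensor_rel (<< (a *: v + v', w) >> - (a *: << (v, w) >> + << (v', w) >>))
| tensor_rel_right a v w w' :
    tensor_rel (<< (v, a *: w + w') >> - (a *: << (v, w) >> + << (v, w') >>)).

Definition tensor_pred : {pred {malg k[(V * W)%type]}} :=
  fun r => `[< tensor_rel r >].

Lemma tensor_pred_submod : submod_closed tensor_pred.
Proof.
split=> [|a r s /asboolP hr /asboolP hs]; apply/asboolP.
  exact: tensor_rel0.
exact: tensor_rel_lin.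
Qed.

HB.instance Definition _ :=
  GRing.isSubmodClosed.Build k {malg k[(V * W)%type]} tensor_pred
    tensor_pred_submod.

Definition tensor : Type := Quotient.quot tensor_pred.

HB.instance Definition _ := GRing.Zmodule.on tensor.

Definition tensor_pi (r : {malg k[(V * W)%type]}) : tensor :=
  \pi_(Quotient.quot tensor_pred) r.

Definition tensor_repr (t : tensor) : {malg k[(V * W)%type]} :=
  repr (t : Quotient.quot tensor_pred).

Lemma tensor_reprK : cancel tensor_repr tensor_pi.
Proof. by move=> t; rewrite /tensor_pi reprK. Qed.

Lemma tensor_pi_eq r s : tensor_pi r = tensor_pi s <-> tensor_rel (r - s).
Proof.
have E := @Quotient.idealrBE _ tensor_pred r s.
split=> [/eqP e|/asboolP e]; last by apply/eqP; rewrite -[_ == _]E.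
by apply/asboolP; rewrite -[X in is_true X]/(r - s \in tensor_pred) E.
Qed.

Lemma tensor_piB : {morph tensor_pi : r s / r - s}.
Proof. exact: (@raddfB _ _ (\pi_(Quotient.quot tensor_pred))). Qed.

Lemma tensor_piD : {morph tensor_pi : r s / r + s}.
Proof. exact: (@raddfD _ _ (\pi_(Quotient.quot tensor_pred))). Qed.

Lemma tensor_relZ a r : tensor_rel r -> tensor_rel (a *: r).
Proof.
by move=> hr; rewrite -[a *: r]addr0; apply: tensor_rel_lin => //; apply: tensor_rel0.
Qed.

Definition tensor_scale (a : k) (t : tensor) : tensor :=
  tensor_pi (a *: tensor_repr t).

Lemma tensor_piZ a r : tensor_pi (a *: r) = tensor_scale a (tensor_pi r).
Proof.
apply/tensor_pi_eq; rewrite -scalerBr; apply/tensor_relZ/tensor_pi_eq.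
by rewrite tensor_reprK.
Qed.

Fact tensor_scaleA a b t :
  tensor_scale a (tensor_scale b t) = tensor_scale (a * b) t.
Proof. by rewrite -[t]tensor_reprK -!tensor_piZ scalerA. Qed.

Fact tensor_scale1 : left_id 1 tensor_scale.
Proof. by move=> t; rewrite -[t]tensor_reprK -tensor_piZ scale1r. Qed.

Fact tensor_scaleDr : right_distributive tensor_scale +%R.
Proof.
move=> a t u; rewrite -[t]tensor_reprK -[u]tensor_reprK.
by rewrite -tensor_piD -!tensor_piZ -tensor_piD scalerDr.
Qed.

Fact tensor_scaleDl t : {morph tensor_scale^~ t : a b / a + b}.
Proof.
by move=> a b; rewrite -[t]tensor_reprK -!tensor_piZ -tensor_piD scalerDl.
Qed.

HB.instance Definition _ := GRing.Zmodule_isLmodule.Build k tensor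
  tensor_scaleA tensor_scale1 tensor_scaleDr tensor_scaleDl.

Lemma tensor_pi_is_linear : linear tensor_pi.
Proof. by move=> a r s; rewrite tensor_piD tensor_piZ. Qed.

HB.instance Definition _ :=
  GRing.isLinear.Build k {malg k[(V * W)%type]} tensor *:%R tensor_pi
    tensor_pi_is_linear.

Definition tens (v : V) (w : W) : tensor := tensor_pi << (v, w) >>.

Lemma tens_linearl w : linear (tens^~ w).
Proof.
move=> a v v'; rewrite /tens -linearP; apply/tensor_pi_eq.
exact: tensor_rel_left.
Qed.

Lemma tens_linearr v : linear (tens v).
Proof.
move=> a w w'; rewrite /tens -linearP; apply/tensor_pi_eq.
exact: tensor_rel_right.
Qed.

End TensorDef.

Section TensorLift.
Variables (k : fieldType) (V W Z : lmodType k) (f : V -> W -> Z).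

Definition tensor_lift (t : tensor V W) : Z :=
  lin_ext (fun p => f p.1 p.2) (tensor_repr t).

Hypothesis fl : forall w, linear (f^~ w).
Hypothesis fr : forall v, linear (f v).

Lemma tensor_lift_pi r :
  tensor_lift (tensor_pi r) = lin_ext (fun p => f p.1 p.2) r.
Proof.
apply/eqP; rewrite -subr_eq0 -linearB; apply/eqP.
have /tensor_pi_eq := tensor_reprK (tensor_pi r).
elim=> [|a s t _ s0 _ t0|a v v' w|a v w w'].
- by rewrite linear0.
- by rewrite linearP /= s0 t0 scaler0 addr0.
- by rewrite linearB linearP /= !lin_extU /= fl subrr.
- by rewrite linearB linearP /= !lin_extU /= fr subrr.
Qed.

Lemma tensor_lift_is_linear : linear tensor_lift.
Proof.
move=> a t u; rewrite -[t]tensor_reprK -[u]tensor_reprK -linearP.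
by rewrite !tensor_lift_pi linearP.
Qed.

Lemma tensor_lift_tens v w : tensor_lift (tens v w) = f v w.
Proof. by rewrite tensor_lift_pi lin_extU. Qed.

End TensorLift.

Section TensorMap.
Variables (k : fieldType) (V V' W : lmodType k) (f : {linear V -> V'}).

(* [f (x) id_W] *)
Definition tensor_map : tensor V W -> tensor V' W :=
  tensor_lift (fun v w => tens (f v) w).

Fact tensor_map_linearl (w : W) : linear (fun v => tens (f v) w : tensor V' W).
Proof. by move=> a v v'; rewrite linearP tens_linearl. Qed.

Lemma tensor_map_is_linear : linear tensor_map.
Proof.
by apply: tensor_lift_is_linear => [w|v]; [exact: tensor_map_linearl|exact: tens_linearr].
Qed.

HB.instance Definition _ :=
  GRing.isLinear.Build k (tensor V W) (tensor V' W) *:%R tensor_map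
    tensor_map_is_linear.

Lemma tensor_map_tens v w : tensor_map (tens v w) = tens (f v) w.
Proof.
by apply: tensor_lift_tens => *; [exact: tensor_map_linearl|exact: tens_linearr].
Qed.

End TensorMap.

Arguments tensor_map {k V V'} W f t.

Section DirectSumMap.
Variables (k : fieldType) (V V' W W' : lmodType k).
Variables (f : {linear V -> V'}) (g : {linear W -> W'}).

Definition sum_map (p : V * W) : V' * W' := (f p.1, g p.2).

Lemma sum_map_is_linear : linear sum_map.
Proof. by move=> a [v w] [v' w']; rewrite /sum_map /= !linearP. Qed.

HB.instance Definition _ :=
  GRing.isLinear.Build k (V * W)%type (V' * W')%type *:%R sum_map
    sum_map_is_linear.

End DirectSumMap.

Record rep (Q : quiver) (k : fieldType) := Rep {
  rep_at :> Q -> lmodType k;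
  rep_map : forall x y : Q, arrow x y -> {linear rep_at x -> rep_at y}
}.

Section Representations.
Variables (Q : quiver) (k : fieldType).
Local Notation Rep_Q := (rep Q k).
Implicit Types (L M N : Rep_Q) (S : subquiver Q) (a x y : Q).

Record rep_hom M N := RepHom {
  hom_at :> forall x, {linear M x -> N x};
  hom_natural : forall x y (alpha : arrow x y) (v : M x),
    hom_at y (rep_map M alpha v) = rep_map N alpha (hom_at x v)
}.

Definition rep_iso M N : Prop :=
  exists (f : rep_hom M N) (g : rep_hom N M),
    forall x, cancel (f x) (g x) /\ cancel (g x) (f x).

(* exactness of [0 -> L -> M -> N -> 0], computed at each vertex *)
Definition short_exact L M N (f : rep_hom L M) (g : rep_hom M N) : Prop :=
  forall x,
    [/\ injective (f x),
        (forall v : M x, g x v = 0 <-> exists u : L x, f x u = v)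
      & (forall w : N x, exists v : M x, g x v = w)].

Definition rep_zero : Rep_Q :=
  Rep (rep_at := fun=> 'rV[k]_0) (fun _ _ _ => GRing.null_fun _ : {linear _ -> _}).

Definition rep_add M N : Rep_Q :=
  Rep (rep_at := fun x => (M x * N x)%type)
    (fun _ _ alpha => sum_map (rep_map M alpha) (rep_map N alpha)).

Fixpoint rep_sum (n : nat) : ('I_n -> Rep_Q) -> Rep_Q :=
  match n with
  | 0 => fun _ => rep_zero
  | m.+1 => fun F => rep_add (F ord0) (rep_sum (fun i => F (lift ord0 i)))
  end.

Definition rep_tensor M (U : lmodType k) : Rep_Q :=
  Rep (rep_at := fun x => tensor (M x) U)
    (fun _ _ alpha => tensor_map U (rep_map M alpha)).

Local Notation path_space x y := {malg k[{classic qpath x y}]}.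

Definition path_vec x y (p : qpath x y) : path_space x y :=
  << (p : {classic qpath x y}) >>.

Definition proj_rep a : Rep_Q :=
  Rep (rep_at := fun x => path_space a x)
    (fun x y alpha =>
       lin_ext (fun p : {classic qpath a x} => path_vec (prcons p alpha))).

Definition inj_basis_map a x y (alpha : arrow x y) (p : qpath x a) :
    path_space y a :=
  if pselect (exists q : qpath y a, p = pcons alpha q) is left e
  then path_vec (projT1 (cid e)) else 0.

Lemma inj_basis_map_pcons a x y (alpha : arrow x y) (q : qpath y a) :
  inj_basis_map alpha (pcons alpha q) = path_vec q.
Proof.
rewrite /inj_basis_map; case: pselect => [e|[]]; last by exists q.
by case: cid => r /= /pcons_inj ->.
Qed.

Lemma inj_basis_map0 a x y (alpha : arrow x y) (p : qpath x a) :
  ~ (exists q : qpath y a, p = pcons alpha q) -> inj_basis_map alpha p = 0.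
Proof. by rewrite /inj_basis_map; case: pselect. Qed.

Definition inj_rep a : Rep_Q :=
  Rep (rep_at := fun x => path_space x a)
    (fun x y alpha =>
       lin_ext (fun p : {classic qpath x a} => inj_basis_map alpha p)).

Definition in_Proj M : Prop :=
  exists (n : nat) (a : 'I_n -> Q) (U : 'I_n -> lmodType k),
    rep_iso M (rep_sum (fun i => rep_tensor (proj_rep (a i)) (U i))).

Definition in_Inj M : Prop :=
  exists (n : nat) (a : 'I_n -> Q) (U : 'I_n -> lmodType k),
    rep_iso M (rep_sum (fun i => rep_tensor (inj_rep (a i)) (U i))).

Definition almost_fin_presented M : Prop :=
  exists (P1 P0 : Rep_Q) (f : rep_hom P1 P0) (g : rep_hom P0 M),
    [/\ in_Proj P1, in_Proj P0 & short_exact f g].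

Definition almost_fin_copresented M : Prop :=
  exists (I0 I1 : Rep_Q) (f : rep_hom M I0) (g : rep_hom I0 I1),
    [/\ in_Inj I0, in_Inj I1 & short_exact f g].

Definition supp M : subquiver Q :=
  full_on [set x | exists v : M x, v != 0].

Definition restr_at S M x : lmodType k :=
  if pselect (sub_vertex S x) then M x else 'rV[k]_0.

Definition restr_map S M x y (alpha : arrow x y) :
    {linear restr_at S M x -> restr_at S M y} :=
  match pselect (sub_vertex S x) as b, pselect (sub_vertex S y) as c
    return {linear (if b then M x else 'rV[k]_0 : lmodType k) ->
                   (if c then M y else 'rV[k]_0 : lmodType k)} with
  | left _, left _ =>
      if pselect (sub_arrow S alpha) then rep_map M alpha else GRing.null_fun _
  | _, _ => GRing.null_fun _
  end.

Definition restr S M : Rep_Q :=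
  Rep (rep_at := restr_at S M) (@restr_map S M).

Definition projective_on S M : Prop := in_Proj (restr S M).

Definition injective_on S M : Prop := in_Inj (restr S M).

End Representations.

(* Main.v *)
Require Import Defs.
From HB Require Import structures.
From mathcomp Require Import all_boot all_algebra.
From mathcomp Require Import finmap monalg boolp classical_sets cardinality.

Set Implicit Arguments.
Unset Strict Implicit.
Unset Printing Implicit Defensive.

Import GRing.Theory.

Local Open Scope classical_set_scope.
Local Open Scope ring_scope.

(* [P_a (x) U] is the free representation on the space [U] placed at [a]:
   morphisms to [X] are linear maps [U -> X a]. Dually [I_a (x) U] is cofree,
   because the sets of paths are finite. So [Proj(Q)] and [Inj(Q)] consist of
   the representations that are (co)free on a finite family, and both halves of
   the theorem are proved by checking universal properties.

   If [0 -> P1 -> P0 -> M -> 0] is exact, let [V] be the set of predecessors of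
   the generators. A free representation [N] with generators in [V] has, off
   [V], the universal property of the representation generated by the images of
   the arrows leaving [V]; this passes to the cokernel [M]. Interval-finiteness
   makes the support of [M] inside [V] finite.

   Conversely, if [M] is projective on [S] and [D] is the finite rest of the
   support, let [P1] be free on the spaces [M x] placed at [y], for the arrows
   [x -> y] with [x] in [D]. The extension of [M] by [P1] given by the
   tautological maps [M x -> P1 y] is free on the generators of [M_S] and the
   spaces [M x], [x] in [D]. *)

(** * Linear maps, switches and factorizations *)

Section LinearMaps.
Variables (k : fieldType) (V W : lmodType k).

Definition lmap (f : V -> W) (lf : linear f) : {linear V -> W} :=
  HB.pack f (GRing.isLinear.Build k V W *:%R f lf).

(** Switching vectors off, instead of replacing their space by zero, lets a representation be cut
    down to a set of vertices with all its types unchanged. *)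
Definition gate (P : Prop) (v : V) : V := if pselect P then v else 0.

Lemma gate_is_linear P : linear (gate P).
Proof. by move=> c v w; rewrite /gate; case: pselect => //= _; rewrite scaler0 addr0. Qed.

HB.instance Definition _ P :=
  GRing.isLinear.Build k V V *:%R (gate P) (gate_is_linear P).

Lemma fst_is_linear : linear (@fst V W).
Proof. by []. Qed.

Lemma snd_is_linear : linear (@snd V W).
Proof. by []. Qed.

Lemma inl_is_linear : linear (fun v : V => (v, 0 : W)).
Proof. by move=> c v w; congr pair; rewrite /= scaler0 addr0. Qed.

Lemma inr_is_linear : linear (fun w : W => (0 : V, w)).
Proof. by move=> c v w; congr pair; rewrite /= scaler0 addr0. Qed.

Lemma gateT (P : Prop) v : P -> gate P v = v.
Proof. by rewrite /gate; case: pselect. Qed.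

Lemma gateF (P : Prop) v : ~ P -> gate P v = 0.
Proof. by rewrite /gate; case: pselect. Qed.

End LinearMaps.

Section Factorization.
Variables (k : fieldType) (U V W : lmodType k).

(** Any set-theoretic section of [g] will do: its failure to be linear lies in the kernel of [g],
    where [t] vanishes. *)
Lemma lfactor_surj (g : {linear U -> V}) (t : {linear U -> W}) :
  (forall v, exists u, g u = v) -> (forall u, g u = 0 -> t u = 0) ->
  exists s : {linear V -> W}, forall u, s (g u) = t u.
Proof.
move=> /choice[r rK] t0.
have tr u : t (r (g u)) = t u.
  by apply/eqP; rewrite -subr_eq0 -linearB t0 // linearB rK subrr.
have ls : linear (t \o r).
  move=> c v w /=; rewrite -linearP.
  by apply/eqP; rewrite -subr_eq0 -linearB t0 // linearB linearP !rK subrr.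
by exists (lmap ls) => u; exact: tr.
Qed.

(** Preimages under [f] are unique, so choosing them is automatically linear. *)
Lemma lfactor_inj (f : {linear V -> W}) (t : {linear U -> W}) :
  injective f -> (forall u, exists v, f v = t u) ->
  exists s : {linear U -> V}, forall u, f (s u) = t u.
Proof.
move=> f_inj /choice[r rK].
have lr : linear r by move=> c v w; apply: f_inj; rewrite linearP !rK linearP.
by exists (lmap lr).
Qed.

End Factorization.

Lemma extend_along_bij (J I : Type) (e : J -> I) (T : I -> Type)
    (h : forall j, T (e j)) :
  bijective e -> exists h' : forall i, T i, forall j, h' (e j) = h j.
Proof.
case=> g eK gK; exists (fun i => eq_rect _ T (h (g i)) i (gK i)) => j.
(* Once [g (e j)] is rewritten to [j], the transport runs along a proof of [e j = e j], which is
   reflexivity by proof irrelevance. *)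
move: (gK (e j)); rewrite (eK j) => E.
by rewrite (Prop_irrelevance E erefl).
Qed.

Lemma dchoice (I : Type) (T : I -> Type) (P : forall i, T i -> Prop) :
  (forall i, exists t, P i t) -> exists f : forall i, T i, forall i, P i (f i).
Proof. by move=> e; exists (fun i => sval (cid (e i))) => i; exact: svalP. Qed.

(** * Free and cofree representations *)

Section Universal.
Variables (Q : quiver) (k : fieldType).
Local Notation Rep_Q := (rep Q k).
Implicit Types (L M N X : Rep_Q) (V : set Q).

Definition hom_id M : rep_hom M M :=
  RepHom (hom_at := fun x => idfun) (fun _ _ _ _ => erefl).

Lemma hom_comp_natural L M N (g : rep_hom M N) (f : rep_hom L M) x y
    (al : arrow x y) v :
  (g y \o f y) (rep_map L al v) = rep_map N al ((g x \o f x) v).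
Proof. by rewrite /= !hom_natural. Qed.

Definition hom_comp L M N (g : rep_hom M N) (f : rep_hom L M) : rep_hom L N :=
  RepHom (hom_at := fun x => g x \o f x) (hom_comp_natural g f).

(** [N] represents the functor that sends [X] to the families of linear maps [U i -> X (a i)]. Whole
    spaces [U i] serve as generators, so no bases are chosen. For finite [I] this characterizes the
    direct sum of the $P_{a_i} \otimes U_i$ up to isomorphism. *)
Definition is_free N (I : Type) (a : I -> Q) (U : I -> lmodType k)
    (u : forall i, {linear U i -> N (a i)}) : Prop :=
  (forall X (h : forall i, {linear U i -> X (a i)}),
     exists f : rep_hom N X, forall i v, f (a i) (u i v) = h i v) /\
  (forall X (f g : rep_hom N X),
     (forall i v, f (a i) (u i v) = g (a i) (u i v)) -> forall x, f x =1 g x).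

Definition is_cofree N (I : Type) (a : I -> Q) (U : I -> lmodType k)
    (u : forall i, {linear N (a i) -> U i}) : Prop :=
  (forall X (h : forall i, {linear X (a i) -> U i}),
     exists f : rep_hom X N, forall i v, u i (f (a i) v) = h i v) /\
  (forall X (f g : rep_hom X N),
     (forall i v, u i (f (a i) v) = u i (g (a i) v)) -> forall x, f x =1 g x).

(** This trades finite index types for the ordinals used by [in_Proj]. Existence over [J] is the
    part that extends a dependent family along [e]. *)
Lemma is_free_reindex (J I : Type) (e : J -> I) N a U u : bijective e ->
  @is_free N J (a \o e) (U \o e) (fun j => u (e j)) <-> @is_free N I a U u.
Proof.
move=> eb; have [g _ gK] := eb; split=> -[ex un]; split=> X.
- move=> h; have [f fE] := ex X (fun j => h (e j)).
  by exists f => i v; move: v; rewrite -(gK i); exact: fE.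
- by move=> f1 f2 E; apply: un => j; apply: E.
- move=> h; have [h' h'E] := @extend_along_bij _ _ e
    (fun i => {linear U i -> X (a i)}) h eb.
  by have [f fE] := ex X h'; exists f => j v; rewrite fE h'E.
- move=> f1 f2 E; apply: un => i; rewrite -(gK i); exact: E.
Qed.

Lemma is_cofree_reindex (J I : Type) (e : J -> I) N a U u : bijective e ->
  @is_cofree N J (a \o e) (U \o e) (fun j => u (e j)) <-> @is_cofree N I a U u.
Proof.
move=> eb; have [g _ gK] := eb; split=> -[ex un]; split=> X.
- move=> h; have [f fE] := ex X (fun j => h (e j)).
  by exists f => i; rewrite -(gK i); exact: fE.
- by move=> f1 f2 E; apply: un => j; apply: E.
- move=> h; have [h' h'E] := @extend_along_bij _ _ e
    (fun i => {linear X (a i) -> U i}) h eb.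
  by have [f fE] := ex X h'; exists f => j v; rewrite fE h'E.
- move=> f1 f2 E; apply: un => i; rewrite -(gK i); exact: E.
Qed.

(** Both composites fix the generators, hence are the identity by uniqueness. *)
Lemma free_iso M N (I : Type) (a : I -> Q) (U : I -> lmodType k) u w :
  @is_free M I a U u -> @is_free N I a U w -> rep_iso M N.
Proof.
move=> [Mex Mun] [Nex Nun].
have [f fE] := Mex N w; have [g gE] := Nex M u; exists f, g => x; split.
- by apply: (Mun _ (hom_comp g f) (hom_id M)) => i v /=; rewrite fE gE.
- by apply: (Nun _ (hom_comp f g) (hom_id N)) => i v /=; rewrite gE fE.
Qed.

Lemma cofree_iso M N (I : Type) (a : I -> Q) (U : I -> lmodType k) u w :
  @is_cofree M I a U u -> @is_cofree N I a U w -> rep_iso M N.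
Proof.
move=> [Mex Mun] [Nex Nun].
have [f fE] := Nex M u; have [g gE] := Mex N w; exists f, g => x; split.
- by apply: (Mun _ (hom_comp g f) (hom_id M)) => i v /=; rewrite gE fE.
- by apply: (Nun _ (hom_comp f g) (hom_id N)) => i v /=; rewrite fE gE.
Qed.

Lemma free_of_iso M N (I : Type) (a : I -> Q) (U : I -> lmodType k) w :
  rep_iso M N -> @is_free N I a U w ->
  exists u : forall i, {linear U i -> M (a i)}, is_free u.
Proof.
move=> [f [g fgK]] [ex un].
exists (fun i => g (a i) \o w i); split=> X.
  move=> h; have [t tE] := ex X h; exists (hom_comp t f) => i v /=.
  by rewrite (fgK _).2 tE.
move=> t t' E x v; rewrite -((fgK x).1 v).
exact: (un _ (hom_comp t g) (hom_comp t' g)).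
Qed.

Lemma cofree_of_iso M N (I : Type) (a : I -> Q) (U : I -> lmodType k) w :
  rep_iso M N -> @is_cofree N I a U w ->
  exists u : forall i, {linear M (a i) -> U i}, is_cofree u.
Proof.
move=> [f [g fgK]] [ex un].
exists (fun i => w i \o f (a i)); split=> X.
  move=> h; have [t tE] := ex X h; exists (hom_comp g t) => i v /=.
  by rewrite (fgK _).2 tE.
move=> t t' E x v; apply: (can_inj (fgK x).1).
exact: (un _ (hom_comp f t) (hom_comp f t')).
Qed.

(* The direct sum of [M] and [N] with the arrows twisted by [K]. The switches
   [P] and [R] kill arrows of either summand, so that [M] on a set of vertices
   and [N] off it can be glued along [K] without dependent types. *)
Section Twist.
Variables (M N : Rep_Q) (P R : Q -> Q -> Prop).
Variable K : forall x y, arrow x y -> {linear M x -> N y}.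

Definition twist_map x y (al : arrow x y) (p : M x * N x) : M y * N y :=
  (gate (P x y) (rep_map M al p.1), gate (R x y) (rep_map N al p.2) + K al p.1).

Lemma twist_map_is_linear x y (al : arrow x y) : linear (twist_map al).
Proof.
move=> c [m n] [m' n']; rewrite /twist_map /= !linearP; congr pair.
by rewrite /= scalerDr addrACA.
Qed.

Definition twist : Rep_Q :=
  Rep (rep_at := fun x => (M x * N x)%type)
    (fun x y al => lmap (twist_map_is_linear al)).

End Twist.

Definition gated N (P : Q -> Q -> Prop) : Rep_Q :=
  Rep (rep_at := N) (fun x y al => gate (P x y) \o rep_map N al).

Definition pred_closed V := forall x y : Q, arrow x y -> V y -> V x.
Definition succ_closed V := forall x y : Q, arrow x y -> V x -> V y.

(* [free_off V N] says that, outside [V], [N] is freely generated by the images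
   of the arrows leaving [V]; only the values of [t] outside [V] matter. *)
Definition free_off V N : Prop :=
  (forall X (h : forall x y, arrow x y -> {linear N x -> X y}),
     exists t : forall z, {linear N z -> X z},
     forall x y (al : arrow x y) v, ~ V y ->
       (V x -> t y (rep_map N al v) = h x y al v) /\
       (~ V x -> t y (rep_map N al v) = rep_map X al (t x v))) /\
  (forall X (t s : forall z, {linear N z -> X z}),
     (forall x y (al : arrow x y) v, ~ V x -> ~ V y ->
        t y (rep_map N al v) = rep_map X al (t x v) /\
        s y (rep_map N al v) = rep_map X al (s x v)) ->
     (forall x y (al : arrow x y) v, V x -> ~ V y ->
        t y (rep_map N al v) = s y (rep_map N al v)) ->
     forall z, ~ V z -> t z =1 s z).

Definition cofree_off V N : Prop :=
  (forall X (h : forall x y, arrow x y -> {linear X x -> N y}),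
     exists t : forall z, {linear X z -> N z},
     forall x y (al : arrow x y) v, ~ V x ->
       (V y -> rep_map N al (t x v) = h x y al v) /\
       (~ V y -> rep_map N al (t x v) = t y (rep_map X al v))) /\
  (forall X (t s : forall z, {linear X z -> N z}),
     (forall x y (al : arrow x y) v, ~ V x -> ~ V y ->
        rep_map N al (t x v) = t y (rep_map X al v) /\
        rep_map N al (s x v) = s y (rep_map X al v)) ->
     (forall x y (al : arrow x y) v, ~ V x -> V y ->
        rep_map N al (t x v) = rep_map N al (s x v)) ->
     forall z, ~ V z -> t z =1 s z).

(** * Free representations outside a set containing the generators *)

Section FreeOff.
Variables (V : set Q) (N : Rep_Q) (I : Type) (a : I -> Q).
Variables (U : I -> lmodType k) (u : forall i, {linear U i -> N (a i)}).
Hypotheses (Nfree : is_free u) (aV : forall i, V (a i)) (Vcl : pred_closed V).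

(* a morphism [N -> glue X h] fixing the generators is the identity on [V] and
   the wanted extension off [V] *)
Let glue X (h : forall x y, arrow x y -> {linear N x -> X y}) : Rep_Q :=
  @twist N X (fun _ y => V y) (fun x _ => ~ V x)
    (fun x y al => gate (V x /\ ~ V y) \o h x y al).

(** Both sides are morphisms from [N] to [N] with the arrows ending off [V] switched off; for
    [gate (V x)] this uses that [V] is predecessor-closed. They agree on the generators, which lie
    in [V]. *)
Let glue_fst X h (f : rep_hom N (@glue X h)) :
  (forall i v, f (a i) (u i v) = (u i v, 0)) ->
  forall x v, (f x v).1 = gate (V x) v.
Proof.
move=> fE.
have fst_nat x y (al : arrow x y) (p : glue h x) :
    lmap (@fst_is_linear _ (N y) (X y))
      (rep_map (glue h) al p) = rep_map (gated N (fun _ y => V y)) al p.1 by [].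
have gate_nat x y (al : arrow x y) (v : N x) :
    gate (V y) (rep_map N al v)
    = rep_map (gated N (fun _ y => V y)) al (gate (V x) v).
  rewrite /=; have [Vy|nVy] := pselect (V y); last by rewrite !gateF.
  by rewrite (gateT v) //; exact: Vcl Vy.
have /= E := Nfree.2 _ (hom_comp
    (@RepHom _ _ (glue h) (gated N (fun _ y => V y)) _ fst_nat) f)
  (@RepHom _ _ N (gated N (fun _ y => V y)) (fun x => gate (V x)) gate_nat).
by apply: E => i v; rewrite fE gateT.
Qed.

(** Existence reads off the second component of a morphism into the glued representation. For
    uniqueness, [t] and [s] are cut off on [V] and paired with [gate (V x)]; this gives two
    morphisms into one glued representation, equal on the generators because these lie in [V]. *)
Lemma free_free_off : free_off V N.
Proof.
split=> X.
  move=> h.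
  have [f fE] := Nfree.1 (glue h)
    (fun i => lmap (@inl_is_linear _ (N (a i)) (X (a i))) \o u i).
  have f1 := glue_fst fE.
  have lin_out x : linear (fun v => (f x v).2) by move=> c v w; rewrite linearP.
  exists (fun x => lmap (lin_out x)) => x y al v nVy; split=> Vx /=.
    rewrite hom_natural /= gateF; last by [].
    by rewrite add0r f1 !gateT.
  rewrite hom_natural /= gateT; last by [].
  by rewrite [gate (_ /\ _) _]gateF ?addr0 //; case.
move=> t s ts_nat ts_eq z nVz v.
(* As [t] and [s] agree after the arrows leaving [V], the gluing built from [t] serves both. *)
pose h x y (al : arrow x y) : {linear N x -> X y} := t y \o rep_map N al.
have lin_f (r : forall z, {linear N z -> X z}) x :
    linear (fun v => (gate (V x) v, gate (~ V x) (r x v)) : glue h x).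
  by move=> c w w'; rewrite !linearP.
have f_nat (r : forall z, {linear N z -> X z}) :
    (forall x y (al : arrow x y) v, ~ V x -> ~ V y ->
       r y (rep_map N al v) = rep_map X al (r x v)) ->
    (forall x y (al : arrow x y) v, V x -> ~ V y ->
       r y (rep_map N al v) = t y (rep_map N al v)) ->
    forall x y (al : arrow x y) v, lmap (lin_f r y) (rep_map N al v)
      = rep_map (glue h) al (lmap (lin_f r x) v).
  move=> r_nat rt x y al w /=; rewrite /twist_map /=; congr pair.
    have [Vy|nVy] := pselect (V y); last by rewrite !gateF.
    by rewrite (gateT w) //; exact: Vcl Vy.
  have [Vy|nVy] := pselect (V y).
    have Vx := Vcl al Vy.
    rewrite gateF; last by move/(_ Vy).
    rewrite gateF; last by move/(_ Vx).
    by rewrite gateF ?addr0 //; case=> _ /(_ Vy).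
  have [Vx|nVx] := pselect (V x).
    rewrite gateT // rt // [gate (~ V x) _]gateF; last by move/(_ Vx).
    by rewrite add0r !gateT.
  by rewrite (gateT _ nVy) !(gateT _ nVx) [gate (_ /\ _) _]gateF ?addr0 ?r_nat //; case.
have t_nat := f_nat t (fun x y al v h1 h2 => (ts_nat x y al v h1 h2).1)
  (fun _ _ _ _ _ _ => erefl).
have s_nat := f_nat s (fun x y al v h1 h2 => (ts_nat x y al v h1 h2).2)
  (fun x y al v h1 h2 => esym (ts_eq x y al v h1 h2)).
have tsE x : lmap (lin_f t x) =1 lmap (lin_f s x).
  apply: (Nfree.2 _ (RepHom t_nat) (RepHom s_nat)) => i w /=.
  by rewrite ![gate (~ _) _]gateF //; exact.
by have := congr1 snd (tsE z v); rewrite /= !gateT.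
Qed.

End FreeOff.

(** * Cofree representations outside a set containing the cogenerators *)

Section CofreeOff.
Variables (V : set Q) (N : Rep_Q) (I : Type) (a : I -> Q).
Variables (U : I -> lmodType k) (u : forall i, {linear N (a i) -> U i}).
Hypotheses (Ncofree : is_cofree u) (aV : forall i, V (a i)).
Hypothesis Vcl : succ_closed V.

(** This is [X] off [V] and [N] on [V], joined by [h] along the arrows entering [V]. A morphism to
    [N] that the cogenerators see as the second projection is the identity on the copy of [N] over
    [V], and gives the wanted map on [X] off [V]. *)
Let glue X (h : forall x y, arrow x y -> {linear X x -> N y}) : Rep_Q :=
  @twist X N (fun _ y => ~ V y) (fun x _ => V x)
    (fun x y al => gate (~ V x /\ V y) \o h x y al).

Let glue_snd X h (f : rep_hom (@glue X h) N) :
  (forall i p, u i (f (a i) p) = u i p.2) ->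
  forall x v, f x (0, v) = gate (V x) v.
Proof.
move=> fE.
have in_nat x y (al : arrow x y) v :
    lmap (@inr_is_linear _ (X y) (N y)) (rep_map (gated N (fun x _ => V x)) al v)
    = rep_map (glue h) al (lmap (@inr_is_linear _ (X x) (N x)) v).
  by rewrite /= /twist_map /= !linear0 addr0.
have gate_nat x y (al : arrow x y) (v : N x) :
    gate (V y) (rep_map (gated N (fun x _ => V x)) al v)
    = rep_map N al (gate (V x) v).
  rewrite /=; have [Vx|nVx] := pselect (V x).
    by rewrite !gateT //; exact: Vcl Vx.
  by rewrite !(gateF _ nVx) !linear0.
have /= E := Ncofree.2 _ (hom_comp f
    (@RepHom _ _ (gated N (fun x _ => V x)) (glue h) _ in_nat))
  (@RepHom _ _ (gated N (fun x _ => V x)) N (fun x => gate (V x)) gate_nat).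
by apply: E => i v; rewrite fE gateT.
Qed.

Lemma cofree_cofree_off : cofree_off V N.
Proof.
split=> X.
  move=> h.
  have [f fE] := Ncofree.1 (glue h)
    (fun i => u i \o lmap (@snd_is_linear _ (X (a i)) (N (a i)))).
  have f2 := glue_snd fE.
  have lin_f x : linear (fun v => f x (v, 0)).
    move=> c v w; rewrite -linearP; congr (f x _); congr pair.
    by rewrite /= scaler0 addr0.
  exists (fun x => lmap (lin_f x)) => x y al v nVx; split=> Vy /=.
    rewrite -(hom_natural f al (v, 0)) /= /twist_map /= linear0 gateF; last by move/(_ Vy).
    by rewrite linear0 add0r f2 !gateT.
  rewrite -(hom_natural f al (v, 0)) /= /twist_map /= linear0 gateT; last by [].
  by rewrite linear0 add0r gateF //; case.
move=> t s ts_nat ts_eq z nVz v.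
pose h x y (al : arrow x y) : {linear X x -> N y} := rep_map N al \o t x.
have lin_f (r : forall z, {linear X z -> N z}) x :
    linear (fun p : glue h x => gate (~ V x) (r x p.1) + gate (V x) p.2).
  by move=> c w w'; rewrite /= !linearP /= scalerDr addrACA.
have f_nat (r : forall z, {linear X z -> N z}) :
    (forall x y (al : arrow x y) v, ~ V x -> ~ V y ->
       rep_map N al (r x v) = r y (rep_map X al v)) ->
    (forall x y (al : arrow x y) v, ~ V x -> V y ->
       rep_map N al (r x v) = rep_map N al (t x v)) ->
    forall x y (al : arrow x y) p,
      lmap (lin_f r y) (rep_map (glue h) al p)
      = rep_map N al (lmap (lin_f r x) p).
  move=> r_nat rt x y al [w n] /=.
  have [Vx|nVx] := pselect (V x).
    have Vy := Vcl al Vx.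
    rewrite gateF; last by move/(_ Vy).
    rewrite [gate (~ V x) _]gateF; last by move/(_ Vx).
    rewrite !add0r !(gateT _ Vx) (gateT _ Vy) gateF ?addr0 //.
    by case=> /(_ Vx).
  rewrite (gateT _ nVx) [gate (V x) n]gateF // addr0.
  rewrite [gate (V x) _]gateF // add0r.
  have [Vy|nVy] := pselect (V y).
    rewrite gateF; last by move/(_ Vy).
    by rewrite add0r !gateT // rt.
  by rewrite !(gateT _ nVy) [gate (V y) _]gateF // addr0 r_nat.
have t_nat := f_nat t (fun x y al v h1 h2 => (ts_nat x y al v h1 h2).1)
  (fun _ _ _ _ _ _ => erefl).
have s_nat := f_nat s (fun x y al v h1 h2 => (ts_nat x y al v h1 h2).2)
  (fun x y al v h1 h2 => esym (ts_eq x y al v h1 h2)).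
have tsE x : lmap (lin_f t x) =1 lmap (lin_f s x).
  apply: (Ncofree.2 _ (RepHom t_nat) (RepHom s_nat)) => i w /=.
  by rewrite ![gate (~ _) _]gateF //; exact.
by have /= := tsE z (v, 0); rewrite !(gateT _ nVz) gateF ?addr0.
Qed.

End CofreeOff.

(** * Passing to cokernels and kernels *)

Section Transfer.
Variables (V : set Q) (L M N : Rep_Q) (f : rep_hom L M) (g : rep_hom M N).
Hypothesis fg : short_exact f g.

(** Let [t] extend [h \o g] on [M]. Off [V], [t \o f] is natural, and it vanishes after the arrows
    leaving [V] because [g \o f] is zero; uniqueness for [L] makes it zero, so [t] descends to
    [N]. *)
Lemma free_off_coker : free_off V L -> free_off V M -> free_off V N.
Proof.
move=> [_ Lun] [Mex Mun].
have gf z w : g z (f z w) = 0 by have [_ ker _] := fg z; apply/ker; exists w.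
split=> X.
  move=> h; have [t tE] := Mex X (fun x y al => h x y al \o g x).
  have tf z : ~ V z -> forall w, t z (f z w) = 0.
    move=> nVz w.
    apply: (Lun X (fun z => t z \o f z) (fun z => \0) _ _ z nVz w).
      move=> x y al v nVx nVy /=.
      by rewrite !linear0 hom_natural (tE _ _ al _ nVy).2.
    by move=> x y al v Vx nVy /=; rewrite hom_natural (tE _ _ al _ nVy).1 //= gf linear0.
  have ex_s z : exists s : {linear N z -> X z}, ~ V z -> forall w, s (g z w) = t z w.
    (* The values on [V] are unconstrained, so zero is put there. *)
    have [Vz|nVz] := pselect (V z); first by exists \0.
    have [||s sE] := @lfactor_surj _ _ _ _ (g z) (t z); last by exists s.
      by have [] := fg z.
    by move=> v; have [_ ker _] := fg z; move=> /ker[w <-]; exact: tf.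
  have [s sE] := dchoice ex_s; exists s => x y al v nVy.
  have [_ _ surj] := fg x; have [w <-] := surj v; rewrite -hom_natural sE //.
  by split=> Vx; [rewrite (tE _ _ al _ nVy).1|rewrite sE // (tE _ _ al _ nVy).2].
move=> t s ts_nat ts_eq z nVz v.
have [_ _ surj] := fg z; have [w <-] := surj v.
apply: (Mun X (fun z => t z \o g z) (fun z => s z \o g z) _ _ z nVz w).
  by move=> x y al m nVx nVy /=; rewrite hom_natural; exact: ts_nat.
by move=> x y al m Vx nVy /=; rewrite hom_natural; exact: ts_eq.
Qed.

(** Dually, uniqueness for [N] shows that [g \o t] is zero off [V], so [t] takes its values in the
    kernel of [g] and lifts to [L]. *)
Lemma cofree_off_ker : cofree_off V M -> cofree_off V N -> cofree_off V L.
Proof.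
move=> [Mex Mun] [_ Nun].
have gf z w : g z (f z w) = 0 by have [_ ker _] := fg z; apply/ker; exists w.
have f_inj z : injective (f z) by have [] := fg z.
split=> X.
  move=> h; have [t tE] := Mex X (fun x y al => f y \o h x y al).
  have gt z : ~ V z -> forall w, g z (t z w) = 0.
    move=> nVz w.
    apply: (Nun X (fun z => g z \o t z) (fun z => \0) _ _ z nVz w).
      move=> x y al v nVx nVy /=.
      by rewrite !linear0 -hom_natural (tE _ _ al _ nVx).2.
    by move=> x y al v nVx Vy /=; rewrite -hom_natural (tE _ _ al _ nVx).1 //= gf linear0.
  have ex_s z : exists s : {linear X z -> L z}, ~ V z -> forall w, f z (s w) = t z w.
    have [Vz|nVz] := pselect (V z); first by exists \0.
    have [||s sE] := @lfactor_inj _ _ _ _ (f z) (t z); last by exists s.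
      exact: f_inj.
    by move=> v; have [_ ker _] := fg z; apply/ker; exact: gt.
  have [s sE] := dchoice ex_s; exists s => x y al v nVx.
  split=> Vy; apply: f_inj; rewrite hom_natural sE //.
    by rewrite (tE _ _ al _ nVx).1.
  by rewrite sE // (tE _ _ al _ nVx).2.
move=> t s ts_nat ts_eq z nVz v; apply: f_inj.
apply: (Mun X (fun z => f z \o t z) (fun z => f z \o s z) _ _ z nVz v).
  move=> x y al m nVx nVy /=; rewrite -!hom_natural.
  by split; congr (f y _); apply ts_nat.
by move=> x y al m nVx Vy /=; rewrite -!hom_natural; congr (f y _); exact: ts_eq.
Qed.

End Transfer.

End Universal.

(** * The representations [P_a (x) U] and [I_a (x) U] *)

Lemma malg_ext (k : fieldType) (K : choiceType) (Z : lmodType k)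
    (f g : {linear {malg k[K]} -> Z}) :
  (forall b, f << b >> = g << b >>) -> f =1 g.
Proof.
move=> fg r; rewrite (monalgE r) !linear_sum; apply: eq_bigr => b _.
suff -> : << r@_b *g b >> = r@_b *: << b >> :> {malg k[K]} by rewrite !linearZ fg.
by apply/malgP => b'; rewrite mcoeffZ !mcoeffU mulrnAr mulr1.
Qed.

(** * Coordinates in the tensor product with a based space *)

Section TensorBasis.
Variables (k : fieldType) (K : choiceType) (U Z : lmodType k).

Lemma tensor_ext (f g : {linear tensor {malg k[K]} U -> Z}) :
  (forall b v, f (tens << b >> v) = g (tens << b >> v)) -> f =1 g.
Proof.
move=> fg t; rewrite -[t]tensor_reprK.
apply: (malg_ext (f := f \o @tensor_pi _ _ _) (g := g \o @tensor_pi _ _ _)).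
move=> [r v] /=; rewrite -/(tens r v).
have lt : linear (fun r : {malg k[K]} => tens r v) by exact: tens_linearl.
apply: (malg_ext (f := f \o lmap lt) (g := g \o lmap lt)) => b; exact: fg.
Qed.

(** This is the coordinate at [b], with values in [U]. For finite [K] the coordinates identify the
    tensor product with the space of all functions [K -> U], by [coef_surj] and [coef_inj]. *)
Definition coef (b : K) : tensor {malg k[K]} U -> U :=
  tensor_lift (fun (r : {malg k[K]}) (v : U) => r@_b *: v).

Lemma coef_linearl b (v : U) : linear (fun r : {malg k[K]} => r@_b *: v).
Proof. by move=> c r s; rewrite mcoeffD mcoeffZ scalerDl scalerA. Qed.

Lemma coef_linearr b (r : {malg k[K]}) : linear (fun v : U => r@_b *: v).
Proof. by move=> c v w; rewrite scalerDr !scalerA mulrC. Qed.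

Lemma coef_is_linear b : linear (coef b).
Proof.
by apply: tensor_lift_is_linear => *; [exact: coef_linearl|exact: coef_linearr].
Qed.

HB.instance Definition _ b :=
  GRing.isLinear.Build k (tensor {malg k[K]} U) U *:%R (coef b) (coef_is_linear b).

Lemma coef_tens b r v : coef b (tens r v) = r@_b *: v.
Proof.
by rewrite /coef tensor_lift_tens // => *; [exact: coef_linearl|exact: coef_linearr].
Qed.

End TensorBasis.

Section FiniteTensorBasis.
Variables (k : fieldType) (K : choiceType) (U : lmodType k).
Hypothesis K_fin : finite_set [set: K].

Let tens_sum (F : K -> U) (s : seq K) : tensor {malg k[K]} U :=
  \sum_(b <- s) tens << b >> (F b).

Let coef_tens_sum F s b : uniq s -> b \in s -> coef b (tens_sum F s) = F b.
Proof.
move=> s_uniq bs; rewrite linear_sum (bigD1_seq b) //= big1 ?addr0.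
  by rewrite coef_tens mcoeffUU scale1r.
by move=> b' /negPf b'b; rewrite coef_tens mcoeffU b'b scale0r.
Qed.

Lemma coef_surj (F : K -> U) : exists t, forall b, coef b t = F b.
Proof.
have /finite_seqP[s sE] := K_fin.
(* The enumeration may repeat elements; each basis vector must be counted once. *)
exists (tens_sum F (undup s)) => b; apply: coef_tens_sum; first exact: undup_uniq.
by rewrite mem_undup; have : [set: K] b by []; rewrite sE.
Qed.

(** A tensor is the sum over [b] of [tens << b >> (coef b t)]. Both sides are linear in [t], so this
    is checked on tensors of basis vectors. *)
Lemma coef_inj (t t' : tensor {malg k[K]} U) :
  (forall b, coef b t = coef b t') -> t = t'.
Proof.
have /finite_seqP[s sE] := K_fin.
have s_all b : b \in undup s.
  by rewrite mem_undup; have : [set: K] b by []; rewrite sE.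
have lin_sum : linear (fun t => tens_sum (fun b => coef b t) (undup s)).
  move=> c v w; rewrite scaler_sumr -big_split; apply: eq_bigr => b _.
  by rewrite linearP tens_linearr.
have sumE : lmap lin_sum =1 idfun.
  apply: (tensor_ext (g := idfun)) => b v /=.
  rewrite /tens_sum (bigD1_seq b) ?undup_uniq //= big1 ?addr0.
    by rewrite coef_tens mcoeffUU scale1r.
  move=> b' b'b; rewrite coef_tens mcoeffU eq_sym (negPf b'b) scale0r.
  have l0 : linear (tens << b' >> : U -> _) by exact: tens_linearr.
  by have := linear0 (lmap l0).
have {}sumE r : tens_sum (fun b => coef b r) (undup s) = r by exact: (sumE r).
by move=> tt'; rewrite -(sumE t) -(sumE t'); apply: eq_bigr => b _; rewrite tt'.
Qed.

End FiniteTensorBasis.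

Lemma finite_enum (I : Type) : finite_set [set: I] ->
  exists (n : nat) (e : 'I_n -> I), bijective e.
Proof.
move=> [n /card_set_bijP[f [fI f_inj f_surj]]]; exists n.
have ex_e (i : 'I_n) : exists x, f x = i.
  by have [x _ <-] := f_surj i (ltn_ord i); exists x.
have [e eK] := choice ex_e; exists e.
have f_lt x : (f x < n)%N by exact: fI.
exists (fun x => Ordinal (f_lt x)) => [i|x]; first by apply: val_inj; rewrite /= eK.
by apply: f_inj; rewrite ?inE // eK.
Qed.

(** * Paths and their action on representations *)

Fixpoint pcat (Q : quiver) (x y z : Q) (p : qpath x y) :
    qpath y z -> qpath x z :=
  match p in qpath x y return qpath y z -> qpath x z with
  | pnil _ => id
  | pcons _ _ _ al p' => fun q => pcons al (pcat p' q)
  end.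

Lemma pcat_pnil (Q : quiver) (x y : Q) (p : qpath x y) : pcat p (pnil y) = p.
Proof. by elim: p => [|? ? ? al p /= ->]. Qed.

Section Models.
Variables (Q : quiver) (k : fieldType).
Local Notation Rep_Q := (rep Q k).
Implicit Types (M N X : Rep_Q).

Fixpoint act X (x y : Q) (p : qpath x y) : {linear X x -> X y} :=
  match p in qpath x y return {linear X x -> X y} with
  | pnil _ => idfun
  | pcons _ _ _ al p' => act X p' \o rep_map X al
  end.

Lemma act_prcons X (x y z : Q) (p : qpath x y) (al : arrow y z) v :
  act X (prcons p al) v = rep_map X al (act X p v).
Proof. by elim: p al v => [|? ? ? be p IH] al v //=; rewrite IH. Qed.

Lemma hom_act X Y (f : rep_hom X Y) (x y : Q) (p : qpath x y) v :
  f y (act X p v) = act Y p (f x v).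
Proof. by elim: p v => [|? ? ? be p IH] v //=; rewrite IH hom_natural. Qed.

(** Induction on the last arrow: [qpath] grows at its start, whereas the arrows act on [P_a] at the
    end of a path. The predicate is generalized so that it can absorb the first arrow. *)
Lemma qpath_rind (a : Q) (P : forall x, qpath a x -> Prop) :
  P a (pnil a) ->
  (forall x y p (al : arrow x y), P x p -> P y (prcons p al)) ->
  forall x p, P x p.
Proof.
move=> P0 PS x p; elim: p P P0 PS => [|{}a y {}x al p IH] P P0 PS //.
apply: (IH (fun x q => P x (pcons al q))); first exact: (PS _ _ (pnil a)).
by move=> z w q be; exact: PS.
Qed.

(** * Freeness of [P_a (x) U] *)

Section Projective.
Variables (a : Q) (U : lmodType k).
Let P := rep_tensor (proj_rep k a) U.

Definition proj_gen : {linear U -> P a} := lmap (tens_linearr (path_vec k (pnil a))).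

Lemma proj_map_path x y (al : arrow x y) (p : qpath a x) :
  rep_map (proj_rep k a) al (path_vec k p) = path_vec k (prcons p al).
Proof. exact: (@lin_extU k {classic qpath a x}). Qed.

Lemma act_proj x (p : qpath a x) v : act P p (proj_gen v) = tens (path_vec k p) v.
Proof.
elim/qpath_rind: x / p => [|x y p al IH] //.
rewrite act_prcons IH; apply: etrans (tensor_map_tens _ _ _) _.
by rewrite proj_map_path.
Qed.

(** By [act_proj] a basis path tensored with [v] is the image of the generator under that path,
    which forces the value of a morphism. Conversely, [act X p (h tt v)] is linear in [v] and
    compatible with appending an arrow to [p]. *)
Lemma proj_free : @is_free Q k P unit (fun=> a) (fun=> U) (fun=> proj_gen).
Proof.
split=> X; last first.
  move=> f g fg x; apply: tensor_ext => p v.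
  by rewrite -[tens _ v](act_proj (p : qpath a x)) !hom_act (fg tt).
move=> h.
pose B x (r : {malg k[{classic qpath a x}]}) (v : U) : X x :=
  lin_ext (fun p : {classic qpath a x} => act X (p : qpath a x) (h tt v)) r.
have Bl x v : linear (B x ^~ v) by exact: lin_ext_is_linear.
have Br x r : linear (B x r).
  move=> c v w; rewrite /B /lin_ext scaler_sumr -big_split; apply: eq_bigr => p _ /=.
  by rewrite !linearP.
pose f x := lmap (tensor_lift_is_linear (Bl x) (Br x)).
have fE x (p : {classic qpath a x}) v :
    f x (tens << p >> v) = act X (p : qpath a x) (h tt v).
  by rewrite [LHS](tensor_lift_tens (Bl x) (Br x)) [LHS]lin_extU.
have f_nat x y (al : arrow x y) t : f y (rep_map P al t) = rep_map X al (f x t).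
  apply: (tensor_ext (f := f y \o rep_map P al) (g := rep_map X al \o f x)).
  move=> p v; transitivity (act X (prcons p al) (h tt v)); last first.
    by rewrite act_prcons; congr (rep_map X al _); exact: esym (fE x p v).
  rewrite -(fE y (prcons p al)); congr (f y _).
  by apply: etrans (tensor_map_tens _ _ _) _; rewrite [X in tens X]proj_map_path.
by exists (RepHom f_nat) => -[] v; rewrite [LHS](fE a (pnil a)).
Qed.

End Projective.

(** * Cofreeness of [I_a (x) U] *)

Section Injective.
Variables (a : Q) (U : lmodType k).
Hypothesis Qfin : forall x, finite_set [set: qpath x a].
Let J := rep_tensor (inj_rep k a) U.

Definition inj_cogen : {linear J a -> U} :=
  @coef k {classic qpath a a} U (pnil a).

Lemma inj_map_path x y (al : arrow x y) (p : qpath x a) :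
  rep_map (inj_rep k a) al (path_vec k p) = inj_basis_map k al p.
Proof. exact: (@lin_extU k {classic qpath x a}). Qed.

(** The arrow strips [al] from the start of a path, so [pcons al p] is the only basis path sent to
    [p]. *)
Lemma coef_inj_map x y (al : arrow x y) (p : qpath y a) (t : J x) :
  coef (p : {classic qpath y a}) (rep_map J al t)
  = coef (pcons al p : {classic qpath x a}) t.
Proof.
apply: (tensor_ext (f := coef (p : {classic qpath y a}) \o rep_map J al)
  (g := coef (pcons al p : {classic qpath x a}))) => q v.
rewrite [RHS]coef_tens mcoeffU.
apply: etrans (congr1 (coef (p : {classic qpath y a})) (tensor_map_tens _ _ _)) _.
rewrite coef_tens; congr (_ *: v).
rewrite [X in mcoeff _ X](inj_map_path al (q : qpath x a)); have [->|qp] := eqVneq q (pcons al p).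
  by rewrite inj_basis_map_pcons /path_vec mcoeffUU.
have [[p' qE]|nq] := pselect (exists p' : qpath y a, (q : qpath x a) = pcons al p').
  rewrite qE inj_basis_map_pcons /path_vec mcoeffU; case: eqP => // p'p.
  by case/eqP: qp; rewrite [LHS]qE p'p.
by rewrite inj_basis_map0 // mcoeff0.
Qed.

Lemma coef_act_inj x y (p : qpath x y) (q : qpath y a) (t : J x) :
  coef (q : {classic qpath y a}) (act J p t)
  = coef (pcat p q : {classic qpath x a}) t.
Proof. by elim: p q t => [|? ? ? al p IH] q t //=; rewrite IH coef_inj_map. Qed.

Lemma inj_cogen_act x (p : qpath x a) (t : J x) :
  inj_cogen (act J p t) = coef (p : {classic qpath x a}) t.
Proof. by rewrite -[in RHS](pcat_pnil p) -coef_act_inj. Qed.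

Let J_ext x (t t' : J x) :
  (forall p : qpath x a, coef (p : {classic qpath x a}) t
     = coef (p : {classic qpath x a}) t') -> t = t'.
Proof. exact: (@coef_inj k {classic qpath x a} U (Qfin x)). Qed.

(** The cogenerator after the action of [p] is the coordinate at [p], so [v] must go to the tensor
    with coordinates [h tt (act X p v)]. It exists because only finitely many paths lead from [x] to
    [a]. *)
Lemma inj_cofree : @is_cofree Q k J unit (fun=> a) (fun=> U) (fun=> inj_cogen).
Proof.
split=> X; last first.
  move=> f g fg x v; apply: J_ext => p.
  by rewrite -!(inj_cogen_act p) -!hom_act (fg tt).
move=> h.
have ex_f x v : exists t : J x, forall p : qpath x a,
    coef (p : {classic qpath x a}) t = h tt (act X p v).
  exact: (@coef_surj k {classic qpath x a} U (Qfin x) (fun p => h tt (act X p v))).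
pose r x v := sval (cid (ex_f x v)).
have rE x v (p : qpath x a) :
    coef (p : {classic qpath x a}) (r x v) = h tt (act X p v).
  exact: (svalP (cid (ex_f x v)) p).
have lr x : linear (r x).
  by move=> c v w; apply: J_ext => p; rewrite rE !linearP /= !rE.
have r_nat x y (al : arrow x y) v :
    lmap (lr y) (rep_map X al v) = rep_map J al (lmap (lr x) v).
  apply: J_ext => p.
  by rewrite [RHS](coef_inj_map al p) /= !rE.
by exists (RepHom r_nat) => -[] v; rewrite [LHS](rE a v (pnil a)).
Qed.

End Injective.

(** * Finite direct sums *)

Definition ord_succ n (o : option 'I_n) : 'I_n.+1 :=
  if o is Some i then lift ord0 i else ord0.

Lemma ord_succ_bij n : bijective (@ord_succ n).
Proof.
exists (unlift ord0) => [[i|]|i] /=; rewrite ?liftK ?unlift_none //.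
by case: unliftP => [j|] ->.
Qed.

Lemma rep_sum_free n (F : 'I_n -> Rep_Q) (a : 'I_n -> Q) (U : 'I_n -> lmodType k)
    (u : forall i, {linear U i -> F i (a i)}) :
  (forall i, @is_free Q k (F i) unit (fun=> a i) (fun=> U i) (fun=> u i)) ->
  exists w : forall i, {linear U i -> rep_sum F (a i)}, is_free w.
Proof.
elim: n F a U u => [|n IH] F a U u Ffree.
  have w (i : 'I_0) : {linear U i -> rep_sum F (a i)} by case: i.
  exists w; split=> X; last by move=> f g _ x v; rewrite (thinmx0 v : v = 0) !linear0.
  move=> h; have z_nat x y (al : arrow x y) (v : rep_zero Q k x) :
      0 = rep_map X al 0 by rewrite linear0.
  by exists (@RepHom _ _ (rep_zero Q k) X (fun=> \0) z_nat) => -[].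
have [w' [w'ex w'un]] := IH _ _ _ _ (fun i => Ffree (lift ord0 i)).
set F' := rep_sum _ in w' w'ex w'un.
(* The two summands of [rep_sum] correspond to [None] and [Some]; the dependent family is defined on
   the option type and moved to the ordinal. *)
have [w wE] := @extend_along_bij _ _ (@ord_succ n)
  (fun i => {linear U i -> rep_sum F (a i)})
  (fun o => match o return {linear U (ord_succ o) -> rep_sum F (a (ord_succ o))} with
    | Some i => lmap (@inr_is_linear _ (F ord0 _) (F' _)) \o w' i
    | None => lmap (@inl_is_linear _ (F ord0 _) (F' _)) \o u ord0
    end) (ord_succ_bij n).
have w0 := wE None; have wS i := wE (Some i); rewrite /= in w0 wS.
exists w; split=> X.
  move=> h; have [f0 f0E] := (Ffree ord0).1 X (fun=> h ord0).
  have [f' f'E] := w'ex X (fun i => h (lift ord0 i)).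
  have lf x : linear (fun p : (F ord0 x * F' x)%type => f0 x p.1 + f' x p.2).
    by move=> c p q; rewrite /= !linearP scalerDr addrACA.
  have f_nat x y (al : arrow x y) (p : rep_sum F x) :
      lmap (lf y) (rep_map (rep_sum F) al p) = rep_map X al (lmap (lf x) p).
    by rewrite /= !hom_natural linearD.
  exists (RepHom f_nat) => i v; case: (unliftP ord0 i) v => [j|] -> v.
    by rewrite wS /= linear0 add0r f'E.
  by rewrite w0 /= linear0 addr0 (f0E tt).
move=> f g fg x [m m'].
have inl_nat y z (al : arrow y z) (p : F ord0 y) :
   lmap (@inl_is_linear _ (F ord0 z) (F' z)) (rep_map (F ord0) al p)
   = rep_map (rep_sum F) al (lmap (@inl_is_linear _ (F ord0 y) (F' y)) p).
  by rewrite /= /sum_map /= linear0.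
have inr_nat y z (al : arrow y z) (p : F' y) :
   lmap (@inr_is_linear _ (F ord0 z) (F' z)) (rep_map F' al p)
   = rep_map (rep_sum F) al (lmap (@inr_is_linear _ (F ord0 y) (F' y)) p).
  by rewrite /= /sum_map /= linear0.
pose il := @RepHom _ _ (F ord0) (rep_sum F) _ inl_nat.
pose ir := @RepHom _ _ F' (rep_sum F) _ inr_nat.
have fl : f x (m, 0) = g x (m, 0).
  apply: ((Ffree ord0).2 X (hom_comp f il) (hom_comp g il)) => _ v /=.
  by have := fg ord0; rewrite w0; apply.
have fr : f x (0, m') = g x (0, m').
  apply: (w'un X (hom_comp f ir) (hom_comp g ir)) => i v /=.
  by have := fg (lift ord0 i); rewrite wS; apply.
have -> : (m, m') = (m, 0) + (0, m') :> rep_sum F x.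
  by congr pair; rewrite /= ?addr0 ?add0r.
by rewrite !linearD; congr (_ + _).
Qed.

Lemma rep_sum_cofree n (F : 'I_n -> Rep_Q) (a : 'I_n -> Q)
    (U : 'I_n -> lmodType k) (u : forall i, {linear F i (a i) -> U i}) :
  (forall i, @is_cofree Q k (F i) unit (fun=> a i) (fun=> U i) (fun=> u i)) ->
  exists w : forall i, {linear rep_sum F (a i) -> U i}, is_cofree w.
Proof.
elim: n F a U u => [|n IH] F a U u Fcofree.
  have w (i : 'I_0) : {linear rep_sum F (a i) -> U i} by case: i.
  exists w; split=> X.
    move=> h; have z_nat x y (al : arrow x y) (v : X x) :
      0 = rep_map (rep_zero Q k) al 0 by rewrite linear0.
    by exists (@RepHom _ _ X (rep_zero Q k) (fun=> \0) z_nat) => -[].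
  by move=> f g _ x v; rewrite [LHS]thinmx0 [RHS]thinmx0.
have [w' [w'ex w'un]] := IH _ _ _ _ (fun i => Fcofree (lift ord0 i)).
set F' := rep_sum _ in w' w'ex w'un.
have [w wE] := @extend_along_bij _ _ (@ord_succ n)
  (fun i => {linear rep_sum F (a i) -> U i})
  (fun o => match o return {linear rep_sum F (a (ord_succ o)) -> U (ord_succ o)} with
    | Some i => w' i \o lmap (@snd_is_linear _ (F ord0 _) (F' _))
    | None => u ord0 \o lmap (@fst_is_linear _ (F ord0 _) (F' _))
    end) (ord_succ_bij n).
have w0 := wE None; have wS i := wE (Some i); rewrite /= in w0 wS.
exists w; split=> X.
  move=> h; have [f0 f0E] := (Fcofree ord0).1 X (fun=> h ord0).
  have [f' f'E] := w'ex X (fun i => h (lift ord0 i)).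
  have lf x : linear (fun v => (f0 x v, f' x v) : (F ord0 x * F' x)%type).
    by move=> c p q; rewrite !linearP.
  have f_nat x y (al : arrow x y) v :
      lmap (lf y) (rep_map X al v) = rep_map (rep_sum F) al (lmap (lf x) v).
    by rewrite /= !hom_natural.
  exists (@RepHom _ _ X (rep_sum F) _ f_nat) => i v.
  case: (unliftP ord0 i) v => [j|] -> v.
    by rewrite wS /= f'E.
  by rewrite w0 /= (f0E tt).
move=> f g fg x v.
have fst_nat y z (al : arrow y z) (p : rep_sum F y) :
   lmap (@fst_is_linear _ (F ord0 z) (F' z)) (rep_map (rep_sum F) al p)
   = rep_map (F ord0) al (lmap (@fst_is_linear _ (F ord0 y) (F' y)) p).
  by [].
have snd_nat y z (al : arrow y z) (p : rep_sum F y) :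
   lmap (@snd_is_linear _ (F ord0 z) (F' z)) (rep_map (rep_sum F) al p)
   = rep_map F' al (lmap (@snd_is_linear _ (F ord0 y) (F' y)) p).
  by [].
pose pl := @RepHom _ _ (rep_sum F) (F ord0) _ fst_nat.
pose pr := @RepHom _ _ (rep_sum F) F' _ snd_nat.
have fl : (f x v).1 = (g x v).1.
  apply: ((Fcofree ord0).2 X (hom_comp pl f) (hom_comp pl g)) => _ m /=.
  by have := fg ord0; rewrite w0; apply.
have fr : (f x v).2 = (g x v).2.
  apply: (w'un X (hom_comp pr f) (hom_comp pr g)) => i m /=.
  by have := fg (lift ord0 i); rewrite wS; apply.
by rewrite (surjective_pairing (f x v)) (surjective_pairing (g x v)) fl fr.
Qed.

(** * [Proj(Q)] and [Inj(Q)] through universal properties *)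

Lemma in_Proj_free M : in_Proj M ->
  exists (n : nat) (a : 'I_n -> Q) (U : 'I_n -> lmodType k)
    (u : forall i, {linear U i -> M (a i)}), is_free u.
Proof.
move=> [n [a [U MP]]]; exists n, a, U.
have [w wfree] := rep_sum_free (fun i => proj_free (a i) (U i)).
exact: free_of_iso MP wfree.
Qed.

(** Allowing any finite index type lets arrows and vertices index the generators. *)
Lemma free_in_Proj M I (a : I -> Q) (U : I -> lmodType k)
    (u : forall i, {linear U i -> M (a i)}) :
  finite_set [set: I] -> is_free u -> in_Proj M.
Proof.
move=> /finite_enum[n [e eb]] /(is_free_reindex _ eb) Mfree.
exists n, (a \o e), (U \o e).
have [w wfree] := rep_sum_free (fun i => proj_free (a (e i)) (U (e i))).
exact: free_iso Mfree wfree.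
Qed.

Lemma exists_free I (a : I -> Q) (U : I -> lmodType k) :
  finite_set [set: I] ->
  exists N (u : forall i, {linear U i -> N (a i)}), is_free u.
Proof.
move=> /finite_enum[n [e eb]].
have [w wfree] := rep_sum_free (fun i => proj_free (a (e i)) (U (e i))).
set N := rep_sum _ in w wfree; exists N.
have [u uE] := @extend_along_bij _ _ _ (fun i => {linear U i -> N (a i)}) w eb.
exists u; apply/(is_free_reindex _ eb).
have [ex un] := wfree; split=> X.
  by move=> h; have [f fE] := ex X h; exists f => i v; rewrite uE fE.
by move=> f g fg; apply: un => i v; have := fg i v; rewrite uE.
Qed.

Section IntervalFinite.
Hypothesis Qfin : interval_finite Q.

Lemma in_Inj_cofree M : in_Inj M ->
  exists (n : nat) (a : 'I_n -> Q) (U : 'I_n -> lmodType k)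
    (u : forall i, {linear M (a i) -> U i}), is_cofree u.
Proof.
move=> [n [a [U MJ]]]; exists n, a, U.
have [w wcofree] := rep_sum_cofree
  (fun i => inj_cofree (U i) (fun x => Qfin x (a i))).
exact: cofree_of_iso MJ wcofree.
Qed.

Lemma cofree_in_Inj M I (a : I -> Q) (U : I -> lmodType k)
    (u : forall i, {linear M (a i) -> U i}) :
  finite_set [set: I] -> is_cofree u -> in_Inj M.
Proof.
move=> /finite_enum[n [e eb]] /(is_cofree_reindex _ eb) Mcofree.
exists n, (a \o e), (U \o e).
have [w wcofree] := rep_sum_cofree
  (fun i => inj_cofree (U (e i)) (fun x => Qfin x (a (e i)))).
exact: cofree_iso Mcofree wcofree.
Qed.

Lemma exists_cofree I (a : I -> Q) (U : I -> lmodType k) :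
  finite_set [set: I] ->
  exists N (u : forall i, {linear N (a i) -> U i}), is_cofree u.
Proof.
move=> /finite_enum[n [e eb]].
have [w wcofree] := rep_sum_cofree
  (fun i => inj_cofree (U (e i)) (fun x => Qfin x (a (e i)))).
set N := rep_sum _ in w wcofree; exists N.
have [u uE] := @extend_along_bij _ _ _ (fun i => {linear N (a i) -> U i}) w eb.
exists u; apply/(is_cofree_reindex _ eb).
have [ex un] := wcofree; split=> X.
  by move=> h; have [f fE] := ex X h; exists f => i v; rewrite uE fE.
by move=> f g fg; apply: un => i v; have := fg i v; rewrite uE.
Qed.

End IntervalFinite.
End Models.

(** * Restrictions and supports *)

Section Restriction.
Variables (Q : quiver) (k : fieldType) (M : rep Q k) (S : subquiver Q).

Lemma supp0 x (v : M x) : ~ sub_vertex (supp M) x -> v = 0.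
Proof. by move=> nx; apply: contra_notP nx => /eqP v0; exists v. Qed.

(** The match repeats the one inside [restr_at], so that each branch is typed by conversion. *)
Definition res_in x : {linear M x -> restr S M x} :=
  match pselect (sub_vertex S x) as b
    return {linear M x -> (if b then M x else 'rV[k]_0 : lmodType k)} with
  | left _ => idfun
  | right _ => \0
  end.

Definition res_out x : {linear restr S M x -> M x} :=
  match pselect (sub_vertex S x) as b
    return {linear (if b then M x else 'rV[k]_0 : lmodType k) -> M x} with
  | left _ => idfun
  | right _ => \0
  end.

Lemma res_inK x (v : M x) : sub_vertex S x -> res_out x (res_in x v) = v.
Proof. by move=> Sx; rewrite /res_out /res_in /= /restr_at; case: pselect. Qed.

Lemma res_outK x (w : restr S M x) : res_in x (res_out x w) = w.
Proof.
move: w; rewrite /res_out /res_in /= /restr_at; case: pselect => //= _ w.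
by rewrite [RHS]thinmx0.
Qed.

Lemma restr0 x (w : restr S M x) : ~ sub_vertex S x -> w = 0.
Proof.
move=> nSx; move: w; rewrite /= /restr_at.
by case: (pselect _) => [/nSx|{}nSx w] //=; exact: thinmx0.
Qed.

Hypotheses (SM : is_subquiver S (supp M)) (Sfull : is_full S (supp M)).

(** Fullness puts every arrow between vertices of [S] into [S]. For any other arrow both sides are
    zero. *)
Lemma restr_mapE x y (al : arrow x y) (w : restr S M x) :
  rep_map (restr S M) al w = res_in y (rep_map M al (res_out x w)).
Proof.
have full : sub_vertex S x -> sub_vertex S y -> sub_arrow S al.
  by move=> Sx Sy; apply: Sfull => //; split; apply: SM.1.
move: w; rewrite /res_out /res_in /= /restr_map /restr_at.
case: pselect => Sx; case: pselect => Sy w //=; last by rewrite linear0.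
by case: pselect => //; case; exact: full.
Qed.

End Restriction.

Arguments res_in {Q k M} S x.
Arguments res_out {Q k M} S x.

Section Support.
Variables (Q : quiver) (k : fieldType) (N : rep Q k).
Variables (I : Type) (a : I -> Q) (U : I -> lmodType k) (O : set Q).

(* The inclusion of the subrepresentation supported on [O] splits, since [O]
   contains the generators. *)
Lemma free_support (u : forall i, {linear U i -> N (a i)}) :
  is_free u -> (forall i, O (a i)) -> succ_closed O ->
  forall z (v : N z), ~ O z -> v = 0.
Proof.
move=> [ex un] Oa Ocl z v nOz.
pose N' := gated N (fun x _ => O x).
have [r rE] := ex N' u.
have i_nat x y (al : arrow x y) (w : N' x) :
    gate (O y) (rep_map N' al w) = rep_map N al (gate (O x) w).
  rewrite /=; have [Ox|nOx] := pselect (O x).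
    by rewrite !gateT //; exact: Ocl Ox.
  by rewrite !(gateF _ nOx) !linear0.
have := un _ (hom_comp (@RepHom _ _ N' N (fun x => gate (O x)) i_nat) r) (hom_id N).
move=> /(_ _ z v) /= <-; first by rewrite gateF.
by move=> i w; rewrite /= rE gateT.
Qed.

(** Dually, the projection of [N] onto its part on [O] has a left inverse, because the cogenerators
    lie in [O]. *)
Lemma cofree_support (u : forall i, {linear N (a i) -> U i}) :
  is_cofree u -> (forall i, O (a i)) -> pred_closed O ->
  forall z (v : N z), ~ O z -> v = 0.
Proof.
move=> [ex un] Oa Ocl z v nOz.
pose N' := gated N (fun _ y => O y).
have [r rE] := ex N' u.
have p_nat x y (al : arrow x y) (w : N x) :
    gate (O y) (rep_map N al w) = rep_map N' al (gate (O x) w).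
  rewrite /=; have [Oy|nOy] := pselect (O y); last by rewrite !gateF.
  by rewrite (gateT w) //; exact: Ocl Oy.
have := un _ (hom_comp r (@RepHom _ _ N N' (fun x => gate (O x)) p_nat)) (hom_id N).
move=> /(_ _ z v) /= <-; first by rewrite gateF // linear0.
by move=> i w; rewrite /= rE gateT.
Qed.

End Support.

(** * Finiteness drawn from the quiver *)

Section Finiteness.
Variable Q : quiver.

Definition arrows := {x : Q & {y : Q & arrow x y}}.
Definition src (t : arrows) : Q := projT1 t.
Definition tgt (t : arrows) : Q := projT1 (projT2 t).
Definition pack x y (al : arrow x y) : arrows := existT _ x (existT _ y al).

Fixpoint path_verts (x y : Q) (p : qpath x y) : set Q :=
  match p with
  | pnil z => [set z]
  | pcons x _ _ _ p' => x |` path_verts p'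
  end.

Lemma path_verts_finite x y (p : qpath x y) : finite_set (path_verts p).
Proof.
elim: p => [z|? ? ? ? p IH] /=; first exact: finite_set1.
by rewrite finite_setU; split=> //; exact: finite_set1.
Qed.

Lemma path_verts_cat x y z (p : qpath x y) (q : qpath y z) :
  path_verts (pcat p q) y.
Proof. by elim: p q => [? [|? ? ? ? ?]|? ? ? ? p IH q] //=; [left|right]. Qed.

Definition leads_to (x y : Q) : Prop := exists p : qpath x y, True.

(** Such a vertex lies on one of the finitely many paths from [x] to [z], each of which has finitely
    many vertices. *)
Lemma hull_finite x z : interval_finite Q ->
  finite_set [set y | leads_to x y /\ leads_to y z].
Proof.
move=> Qfin; apply: (@sub_finite_set _ _ (\bigcup_(p in [set: qpath x z]) path_verts p)).
  by move=> y [[p _] [q _]]; exists (pcat p q) => //; exact: path_verts_cat.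
by apply: bigcup_finite; [exact: Qfin|move=> p _; exact: path_verts_finite].
Qed.

Lemma finite_sig (T : Type) (P : T -> Prop) :
  finite_set [set t | P t] -> finite_set [set: {t | P t}].
Proof.
move=> Pfin; suff <- : @sval _ P @^-1` [set t | P t] = setT.
  by apply: finite_preimage => // -[x px] [y py] _ _ /= xy; exact: eq_exist.
by rewrite eqEsubset; split=> // -[].
Qed.

Lemma finite_arrows_from (D : set Q) (P : arrows -> Prop) : locally_finite Q ->
  finite_set D -> (forall t, P t -> D (src t)) -> finite_set [set: {t | P t}].
Proof.
move=> Qfin Dfin PD; apply: finite_sig.
apply: (@sub_finite_set _ _ (\bigcup_(x in D)
  ((fun t : {y : Q & arrow x y} => pack (projT2 t)) @` setT))).
  by move=> [x [y al]] Pt; exists x; [exact: PD Pt|exists (existT _ y al)].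
by apply: bigcup_finite => // x _; apply: finite_image; exact: (Qfin x).1.
Qed.

Lemma finite_arrows_to (D : set Q) (P : arrows -> Prop) : locally_finite Q ->
  finite_set D -> (forall t, P t -> D (tgt t)) -> finite_set [set: {t | P t}].
Proof.
move=> Qfin Dfin PD; apply: finite_sig.
apply: (@sub_finite_set _ _ (\bigcup_(y in D)
  ((fun t : {x : Q & arrow x y} => pack (projT2 t)) @` setT))).
  by move=> [x [y al]] Pt; exists y; [exact: PD Pt|exists (existT _ x al)].
by apply: bigcup_finite => // y _; apply: finite_image; exact: (Qfin y).2.
Qed.

Lemma finite_sum (A B : Type) : finite_set [set: A] -> finite_set [set: B] ->
  finite_set [set: A + B].
Proof.
move=> Afin Bfin; suff -> : [set: A + B] = (inl @` setT) `|` (inr @` setT).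
  by rewrite finite_setU; split; exact: finite_image.
by rewrite eqEsubset; split=> // -[x|x] _; [left|right]; exists x.
Qed.

End Finiteness.

(** * Families of maps indexed by some of the arrows *)

Section ArrowFamilies.
Variables (Q : quiver) (k : fieldType) (A B : Q -> lmodType k).
Variables (P : arrows Q -> Prop).
Variable h : forall i : {t | P t}, {linear A (src (sval i)) -> B (tgt (sval i))}.

Definition extend0 x y (al : arrow x y) : {linear A x -> B y} :=
  match pselect (P (pack al)) with
  | left Pal => h (exist _ (pack al) Pal)
  | right _ => \0
  end.

Lemma extend0E x y (al : arrow x y) (Pal : P (pack al)) :
  extend0 al =1 h (exist _ (pack al) Pal).
Proof.
move=> v; rewrite /extend0; case: pselect => // Pal'.
by rewrite (Prop_irrelevance Pal' Pal).
Qed.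

Lemma extend0F x y (al : arrow x y) v : ~ P (pack al) -> extend0 al v = 0.
Proof. by rewrite /extend0; case: pselect. Qed.

End ArrowFamilies.

(** * Presentations and restrictions *)

Section Main.
Variables (Q : quiver) (k : fieldType) (M : rep Q k).
Hypothesis hQ : strongly_locally_finite Q.
Implicit Types (X : rep Q k).

(** * The part of the support outside [V] *)

Section OffV.
Variable V : set Q.
Let S := full_on [set x | sub_vertex (supp M) x /\ ~ V x].

Lemma supp_off_is_subquiver : is_subquiver S (supp M).
Proof. by split=> [x []//|x y al] [[? _] [? _]]. Qed.

Lemma supp_off_is_full : is_full S (supp M).
Proof. by []. Qed.

Let outK x (v : M x) : ~ V x -> res_out S x (res_in S x v) = v.
Proof.
move=> nVx; have [Mx|nMx] := pselect (sub_vertex (supp M) x).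
  by apply: res_inK.
by rewrite (supp0 v nMx) !linear0.
Qed.

Let mapE := restr_mapE supp_off_is_subquiver supp_off_is_full.

Let restr_off0 x (w : restr S M x) : V x -> w = 0.
Proof. by move=> Vx; apply: restr0 => -[_ /(_ Vx)]. Qed.

(** The generators are the spaces [M x] placed at [y], for the arrows [x -> y] leaving [V] with [x]
    in the support; local finiteness makes them finite in number. Freeness is then [free_off] read
    on the restriction, since arrows starting outside the support carry only zero. *)
Lemma supp_off_projective : pred_closed V -> free_off V M ->
  finite_set [set x | V x /\ sub_vertex (supp M) x] -> projective_on S M.
Proof.
move=> Vcl [ex un] Vfin.
pose P (t : arrows Q) := [/\ V (src t), ~ V (tgt t) & sub_vertex (supp M) (src t)].
have Pfin : finite_set [set: {t | P t}].
  by apply: (finite_arrows_from hQ.1 Vfin) => t [].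
pose u (i : {t | P t}) : {linear M (src (sval i)) -> restr S M (tgt (sval i))} :=
  res_in S _ \o rep_map M (projT2 (projT2 (sval i))).
apply: (free_in_Proj (u := u) Pfin); split=> X.
  move=> h; have [t tE] := ex X (extend0 h).
  have f_nat x y (al : arrow x y) w :
      (t y \o res_out S y) (rep_map (restr S M) al w)
      = rep_map X al ((t x \o res_out S x) w).
    have [Vx|nVx] := pselect (V x); first by rewrite (restr_off0 w Vx) !linear0.
    have [Vy|nVy] := pselect (V y); first by case: nVx; exact: Vcl Vy.
    by rewrite mapE /= outK // (tE _ _ al _ nVy).2.
  exists (RepHom f_nat) => -[[x [y al]] Pal] v.
  have [Vx nVy _] := Pal.
  by rewrite /= outK // (tE _ _ al _ nVy).1 // (extend0E h Pal).
move=> f g fg z w.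
have [Vz|nVz] := pselect (V z); first by rewrite (restr_off0 w Vz) !linear0.
rewrite -(res_outK w).
apply: (un X (fun z => f z \o res_in S z) (fun z => g z \o res_in S z)) => //.
  have nat (r : rep_hom (restr S M) X) x y (al : arrow x y) v : ~ V x ->
      r y (res_in S y (rep_map M al v)) = rep_map X al (r x (res_in S x v)).
    by move=> nVx; rewrite -(hom_natural r) mapE outK.
  by move=> x y al v nVx nVy; split; exact: nat.
move=> x y al v Vx nVy /=.
have [Mx|nMx] := pselect (sub_vertex (supp M) x).
  have Pal : P (pack al) by split.
  exact: (fg (exist _ _ Pal)).
by rewrite (supp0 v nMx) !linear0.
Qed.

(** Here the cogenerators are the spaces [M y] placed at [x], for the arrows [x -> y] entering [V]
    with [y] in the support. *)
Lemma supp_off_injective : succ_closed V -> cofree_off V M ->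
  finite_set [set x | V x /\ sub_vertex (supp M) x] -> injective_on S M.
Proof.
move=> Vcl [ex un] Vfin.
pose P (t : arrows Q) := [/\ ~ V (src t), V (tgt t) & sub_vertex (supp M) (tgt t)].
have Pfin : finite_set [set: {t | P t}].
  by apply: (finite_arrows_to hQ.1 Vfin) => t [].
pose u (i : {t | P t}) : {linear restr S M (src (sval i)) -> M (tgt (sval i))} :=
  rep_map M (projT2 (projT2 (sval i))) \o res_out S _.
apply: (cofree_in_Inj hQ.2 (u := u) Pfin); split=> X.
  move=> h; have [t tE] := ex X (extend0 h).
  have f_nat x y (al : arrow x y) v :
      (res_in S y \o t y) (rep_map X al v)
      = rep_map (restr S M) al ((res_in S x \o t x) v).
    have [Vy|nVy] := pselect (V y).
      by rewrite [LHS]restr_off0 // [RHS]restr_off0.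
    have [Vx|nVx] := pselect (V x); first by case: nVy; exact: Vcl Vx.
    by rewrite mapE /= outK // (tE _ _ al _ nVx).2.
  exists (RepHom f_nat) => -[[x [y al]] Pal] v.
  have [nVx Vy _] := Pal.
  by rewrite /= outK // (tE _ _ al _ nVx).1 // (extend0E h Pal).
move=> f g fg z v.
have [Vz|nVz] := pselect (V z); first by rewrite [LHS]restr_off0 // [RHS]restr_off0.
rewrite -(res_outK (f z v)) -(res_outK (g z v)); congr (res_in S z _).
apply: (un X (fun z => res_out S z \o f z) (fun z => res_out S z \o g z)) => //.
  have nat (r : rep_hom X (restr S M)) x y (al : arrow x y) w : ~ V y ->
      rep_map M al (res_out S x (r x w)) = res_out S y (r y (rep_map X al w)).
    by move=> nVy; rewrite (hom_natural r) mapE outK.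
  by move=> x y al w nVx nVy; split; exact: nat.
move=> x y al w nVx Vy /=.
have [My|nMy] := pselect (sub_vertex (supp M) y).
  have Pal : P (pack al) by split.
  exact: (fg (exist _ _ Pal)).
by rewrite [LHS]supp0 // [RHS]supp0.
Qed.

Lemma supp_off_cofinite : finite_set [set x | V x /\ sub_vertex (supp M) x] ->
  cofinite S (supp M).
Proof.
move=> Vfin; split=> //; apply: sub_finite_set Vfin => x [Mx nSx]; split=> //.
by apply: contrapT => nVx; apply: nSx.
Qed.

Lemma supp_off_successor_closed : pred_closed V -> successor_closed S (supp M).
Proof.
move=> Vcl x y p; elim: p => [z|{}x {}y z al p IH] /=; first by [].
move=> [[Mx My] Mp] [_ nVx].
have Sy : sub_vertex S y by split=> // /(Vcl _ _ al).
by split; [split|exact: IH].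
Qed.

Lemma supp_off_predecessor_closed : succ_closed V -> predecessor_closed S (supp M).
Proof.
move=> Vcl x y p; elim: p => [z|{}x {}y z al p IH] /=; first by [].
move=> [[Mx My] Mp] Sz; have Sp := IH Mp Sz.
(* The start of [p] is in [S]: directly for a trivial path, and as an end of the first arrow
   otherwise. *)
have Sy : sub_vertex S y by case: p Sp {IH Mp Sz} => [//|? ? ? be p [[]]].
by split=> //; split=> //; split=> // /(Vcl _ _ al); have [_] := Sy.
Qed.

End OffV.

Lemma between_finite (A B : finType) (a : A -> Q) (b : B -> Q) :
  finite_set [set x | (exists i, leads_to (a i) x) /\ (exists j, leads_to x (b j))].
Proof.
apply: (@sub_finite_set _ _ (\bigcup_(p in [set: A * B])
   [set x | leads_to (a p.1) x /\ leads_to x (b p.2)])).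
  by move=> x [[i ix] [j xj]]; exists (i, j).
apply: bigcup_finite => [|p _]; first exact: finite_finset.
exact: hull_finite hQ.2.
Qed.

Lemma predecessors_closed I (a : I -> Q) :
  pred_closed [set x | exists i, leads_to x (a i)].
Proof. by move=> x y al [i [p _]]; exists i; exists (pcons al p). Qed.

Lemma successors_closed I (a : I -> Q) :
  succ_closed [set x | exists i, leads_to (a i) x].
Proof. by move=> x y al [i [p _]]; exists i; exists (prcons p al). Qed.

Lemma presented_projective : almost_fin_presented M ->
  exists S : subquiver Q,
    [/\ is_subquiver S (supp M), cofinite S (supp M),
        successor_closed S (supp M) & projective_on S M].
Proof.
move=> [P1 [P0 [f [g [/in_Proj_free[m [b [W [w wfree]]]]
  /in_Proj_free[n [a [U [u ufree]]]] fg]]]]].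
pose c (i : 'I_n + 'I_m) := match i with inl i => a i | inr j => b j end.
(* The generators of both [P0] and [P1] must lie in [V], as [free_off] is needed for both. *)
pose V := [set x | exists i, leads_to x (c i)].
have Vcl : pred_closed V := @predecessors_closed _ c.
have Va i : V (a i) by exists (inl i); exists (pnil _).
have Vb i : V (b i) by exists (inr i); exists (pnil _).
have M_off : free_off V M.
  exact: (free_off_coker fg (free_free_off wfree Vb Vcl) (free_free_off ufree Va Vcl)).
have Vfin : finite_set [set x | V x /\ sub_vertex (supp M) x].
  (* [M x] is a quotient of [P0 x], so a vertex of the support is a successor of a generator of
     [P0]; lying in [V], it is caught between two finite families. *)
  apply: sub_finite_set (between_finite a c) => x [Vx [v v0]]; split=> //.
  apply: contrapT => nOx; case/negP: v0; apply/eqP.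
  have [_ _ surj] := fg x; have [v' <-] := surj v.
  rewrite (free_support ufree _ (@successors_closed _ a) v' nOx) ?linear0 //.
  by move=> i; exists i; exists (pnil _).
exists (full_on [set x | sub_vertex (supp M) x /\ ~ V x]); split.
- exact: supp_off_is_subquiver.
- exact: supp_off_cofinite.
- exact: supp_off_successor_closed.
- exact: supp_off_projective.
Qed.

Lemma copresented_injective : almost_fin_copresented M ->
  exists S : subquiver Q,
    [/\ is_subquiver S (supp M), cofinite S (supp M),
        predecessor_closed S (supp M) & injective_on S M].
Proof.
move=> [I0 [I1 [f [g [/(in_Inj_cofree hQ.2)[n [a [U [u ucofree]]]]
  /(in_Inj_cofree hQ.2)[m [b [W [w wcofree]]]] fg]]]]].
pose c (i : 'I_n + 'I_m) := match i with inl i => a i | inr j => b j end.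
pose V := [set x | exists i, leads_to (c i) x].
have Vcl : succ_closed V := @successors_closed _ c.
have Va i : V (a i) by exists (inl i); exists (pnil _).
have Vb i : V (b i) by exists (inr i); exists (pnil _).
have M_off : cofree_off V M.
  exact: (cofree_off_ker fg (cofree_cofree_off ucofree Va Vcl)
    (cofree_cofree_off wcofree Vb Vcl)).
have Vfin : finite_set [set x | V x /\ sub_vertex (supp M) x].
  (* [M x] embeds into [I0 x], so a vertex of the support is a predecessor of a cogenerator of
     [I0]. *)
  apply: sub_finite_set (between_finite c a) => x [Vx [v v0]]; split=> //.
  apply: contrapT => nOx; case/negP: v0; apply/eqP.
  have [f_inj _ _] := fg x; apply: f_inj; rewrite linear0.
  apply: (cofree_support ucofree _ (@predecessors_closed _ a) _ nOx).
  by move=> i; exists i; exists (pnil _).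
exists (full_on [set x | sub_vertex (supp M) x /\ ~ V x]); split.
- exact: supp_off_is_subquiver.
- exact: supp_off_cofinite.
- exact: supp_off_predecessor_closed.
- exact: supp_off_injective.
Qed.

(** * From a restriction back to a presentation *)

Section Extension.
Variable S : subquiver Q.
Hypotheses (SM : is_subquiver S (supp M)) (Scof : cofinite S (supp M)).

Let D := [set x | sub_vertex (supp M) x /\ ~ sub_vertex S x].
Let mapE := restr_mapE SM Scof.1.

Let outK x (v : M x) : ~ D x -> res_out S x (res_in S x v) = v.
Proof.
move=> nDx; have [Sx|nSx] := pselect (sub_vertex S x); first exact: res_inK.
by rewrite (@supp0 _ _ M x v) ?linear0 // => Mx; apply: nDx.
Qed.

Let Dfin : finite_set D.
Proof. by have [_] := Scof. Qed.

Let DTfin : finite_set [set: {x | D x}].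
Proof. exact: finite_sig. Qed.

(* The universal extension of [M] by [P1] is freely generated by the generators
   of the restriction of [M] to [S] together with the spaces [M x], [x \in D]. *)
Lemma projective_presented : successor_closed S (supp M) -> projective_on S M ->
  almost_fin_presented M.
Proof.
move=> Scl /in_Proj_free[n [a [U [u [uex uun]]]]].
(* Arrows that end in [D] again are included: maps chosen independently on the spaces [M x] need not
   commute with them. *)
pose P (t : arrows Q) := D (src t).
have Pfin : finite_set [set: {t | P t}] by apply: (finite_arrows_from hQ.1 Dfin).
have [P1 [w wfree]] := exists_free (fun i : {t | P t} => tgt (sval i))
  (fun i => M (src (sval i))) Pfin.
have [wex wun] := wfree.
pose E := twist (M := M) (N := P1) (fun _ _ => True) (fun _ _ => True) (extend0 w).
have E_map x y (al : arrow x y) (m : M x) (xi : P1 x) : rep_map E al (m, xi)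
    = (rep_map M al m, rep_map P1 al xi + extend0 w al m).
  by rewrite /= /twist_map /= !gateT.
have f_nat x y (al : arrow x y) xi :
    lmap (@inr_is_linear _ (M y) (P1 y)) (rep_map P1 al xi)
    = rep_map E al (lmap (@inr_is_linear _ (M x) (P1 x)) xi).
  by rewrite [RHS]E_map /= !linear0 addr0.
have g_nat x y (al : arrow x y) (p : E x) :
    lmap (@fst_is_linear _ (M y) (P1 y)) (rep_map E al p)
    = rep_map M al (lmap (@fst_is_linear _ (M x) (P1 x)) p).
  by case: p => m xi; rewrite E_map.
exists P1, E, (@RepHom _ _ P1 E _ f_nat), (@RepHom _ _ E M _ g_nat); split.
- exact: free_in_Proj Pfin wfree.
- pose c (i : 'I_n + {x | D x}) : Q :=
    match i with inl i => a i | inr x => sval x end.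
  pose T (i : 'I_n + {x | D x}) : lmodType k :=
    match i with inl i => U i | inr x => M (sval x) end.
  pose gen (i : 'I_n + {x | D x}) : {linear T i -> E (c i)} :=
    match i return {linear T i -> E (c i)} with
    | inl i => lmap (@inl_is_linear _ (M (a i)) (P1 (a i))) \o (res_out S (a i) \o u i)
    | inr x => lmap (@inl_is_linear _ (M (sval x)) (P1 (sval x)))
    end.
  apply: (free_in_Proj (u := gen)); first exact: finite_sum.
  (* Successor-closedness: an arrow from [S] to a vertex of the support stays in [S], so no arrow
     carries anything into [D] from outside. *)
  have closed x y (al : arrow x y) (m : M x) : ~ D x -> D y -> rep_map M al m = 0.
    move=> nDx [My nSy]; have [Mx|nMx] := pselect (sub_vertex (supp M) x).
      have Sx : sub_vertex S x by apply: contrapT => nSx; apply: nDx.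
      have [] := Scl x y (pcons al (pnil y)) _ Sx; last by move=> _ /nSy.
      by split.
    by rewrite (supp0 m nMx) linear0.
  split=> X.
    move=> h; have [fS fSE] := uex X (fun i => h (inl i)).
    have ex_t x : exists t : {linear M x -> X x},
        (forall d : D x, t =1 h (inr (exist _ x d))) /\
        (~ D x -> t =1 fS x \o res_in S x).
      have [d|nd] := pselect (D x).
        by exists (h (inr (exist _ x d))); split=> // d'; rewrite (Prop_irrelevance d' d).
      by exists (fS x \o res_in S x); split.
    have [t tE] := dchoice ex_t.
    (* [t] is prescribed by [h] on [D] and by [fS] elsewhere; [F1] records its failure to commute
       with the arrows leaving the vertices of [D], and the twist cancels that failure. *)
    have [F1 F1E] := wex X (fun i => let al := projT2 (projT2 (sval i)) in
      (rep_map X al \o t _) \- (t _ \o rep_map M al)).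
    have lF x : linear (fun p : (M x * P1 x)%type => t x p.1 + F1 x p.2).
      by move=> r p q; rewrite /= !linearP scalerDr addrACA.
    have F_nat x y (al : arrow x y) (p : E x) :
        lmap (lF y) (rep_map E al p) = rep_map X al (lmap (lF x) p).
      case: p => m xi; rewrite E_map /= !linearD hom_natural.
      suff -> : F1 y (extend0 w al m) = rep_map X al (t x m) - t y (rep_map M al m).
        by rewrite addrC -addrA subrK addrC.
      have [Dx|nDx] := pselect (D x).
        have Pal : P (pack al) by [].
        by rewrite (extend0E w Pal); exact: (F1E (exist _ _ Pal) m).
      rewrite extend0F // linear0 (tE x).2 //=.
      have [Dy|nDy] := pselect (D y).
        rewrite closed // linear0 subr0 -(hom_natural fS al (res_in S x m)) mapE.
        by rewrite outK // closed // !linear0.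
      by rewrite (tE y).2 //= -(hom_natural fS al (res_in S x m)) mapE outK // subrr.
    exists (@RepHom _ _ E X _ F_nat) => -[i|[x Dx]] v /=; last first.
      by rewrite linear0 addr0 ((tE x).1 Dx).
    rewrite linear0 addr0 -fSE.
    have [Di|nDi] := pselect (D (a i)); last by rewrite (tE (a i)).2 //= res_outK.
    by rewrite (restr0 (u i v)) ?linear0 //; have [] := Di.
  move=> F G FG.
  (* The restriction embeds into [E], because the twist is zero on arrows starting off [D]. *)
  have j_nat x y (al : arrow x y) (r : restr S M x) :
      (lmap (@inl_is_linear _ (M y) (P1 y)) \o res_out S y) (rep_map (restr S M) al r)
      = rep_map E al ((lmap (@inl_is_linear _ (M x) (P1 x)) \o res_out S x) r).
    have [Dx|nDx] := pselect (D x).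
      by rewrite (restr0 r) ?linear0 //; have [] := Dx.
    rewrite [RHS]E_map linear0 extend0F // addr0 mapE /=; congr pair.
    have [Dy|nDy] := pselect (D y); last exact: outK.
    by rewrite closed // !linear0.
  pose j := @RepHom _ _ (restr S M) E _ j_nat.
  have FGl x (m : M x) : F x (m, 0) = G x (m, 0).
    have [Dx|nDx] := pselect (D x); first exact: (FG (inr (exist _ x Dx))).
    rewrite -(outK m nDx).
    apply: (uun X (hom_comp F j) (hom_comp G j)) => i v; exact: (FG (inl i)).
  have FGr x (xi : P1 x) : F x (0, xi) = G x (0, xi).
    apply: (wun X (hom_comp F (@RepHom _ _ P1 E _ f_nat))
      (hom_comp G (@RepHom _ _ P1 E _ f_nat))) => -[[y [z al]] Pal] v /=.
    (* The twist writes each generator of [P1] in terms of [M], so agreement on [M] implies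
       agreement on [P1]. *)
    have -> : (0, w (exist _ (pack al) Pal) v)
        = rep_map E al (v, 0) - (rep_map M al v, 0) :> E z.
      by rewrite E_map (extend0E w Pal) linear0 add0r; congr pair; rewrite /= ?subrr ?subr0.
    by rewrite !linearB !hom_natural !FGl.
  move=> x [m xi]; have -> : (m, xi) = (m, 0) + (0, xi) :> E x.
    by congr pair; rewrite /= ?addr0 ?add0r.
  by rewrite !linearD FGl FGr.
- move=> x; split=> [xi xi' []//|[m xi]|m]; last by exists (m, 0).
  by split=> [/= ->|[xi' [<- _]]//]; exists xi.
Qed.

(* The universal extension of [J1] by [M] is cofreely cogenerated by the
   cogenerators of the restriction of [M] to [S] together with the spaces
   [M x], [x \in D]. *)
Lemma injective_copresented : predecessor_closed S (supp M) -> injective_on S M ->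
  almost_fin_copresented M.
Proof.
move=> Scl /(in_Inj_cofree hQ.2)[n [a [U [u [uex uun]]]]].
pose P (t : arrows Q) := D (tgt t).
have Pfin : finite_set [set: {t | P t}] by apply: (finite_arrows_to hQ.1 Dfin).
have [J1 [w wcofree]] := exists_cofree hQ.2 (fun i : {t | P t} => src (sval i))
  (fun i => M (tgt (sval i))) Pfin.
have [wex wun] := wcofree.
pose E := twist (M := J1) (N := M) (fun _ _ => True) (fun _ _ => True) (extend0 w).
have E_map x y (al : arrow x y) (xi : J1 x) (m : M x) : rep_map E al (xi, m)
    = (rep_map J1 al xi, rep_map M al m + extend0 w al xi).
  by rewrite /= /twist_map /= !gateT.
have f_nat x y (al : arrow x y) m :
    lmap (@inr_is_linear _ (J1 y) (M y)) (rep_map M al m)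
    = rep_map E al (lmap (@inr_is_linear _ (J1 x) (M x)) m).
  by rewrite [RHS]E_map /= !linear0 addr0.
have g_nat x y (al : arrow x y) (p : E x) :
    lmap (@fst_is_linear _ (J1 y) (M y)) (rep_map E al p)
    = rep_map J1 al (lmap (@fst_is_linear _ (J1 x) (M x)) p).
  by case: p => xi m; rewrite E_map.
pose g := @RepHom _ _ E J1 _ g_nat.
exists E, J1, (@RepHom _ _ M E _ f_nat), g; split.
- pose c (i : 'I_n + {x | D x}) : Q :=
    match i with inl i => a i | inr x => sval x end.
  pose T (i : 'I_n + {x | D x}) : lmodType k :=
    match i with inl i => U i | inr x => M (sval x) end.
  pose cogen (i : 'I_n + {x | D x}) : {linear E (c i) -> T i} :=
    match i return {linear E (c i) -> T i} with
    | inl i => u i \o (res_in S (a i) \o lmap (@snd_is_linear _ (J1 (a i)) (M (a i))))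
    | inr x => lmap (@snd_is_linear _ (J1 (sval x)) (M (sval x)))
    end.
  apply: (cofree_in_Inj hQ.2 (u := cogen)); first exact: finite_sum.
  (* Predecessor-closedness: nothing is carried from [D] to a vertex outside [D]. *)
  have closed x y (al : arrow x y) (m : M x) : D x -> ~ D y -> rep_map M al m = 0.
    move=> [Mx nSx] nDy; have [My|nMy] := pselect (sub_vertex (supp M) y).
      have Sy : sub_vertex S y by apply: contrapT => nSy; apply: nDy.
      have [|al_S _] := Scl x y (pcons al (pnil y)) _ Sy; first by split.
      by case: nSx; exact: (sub_arrow_ends al_S).1.
    exact: supp0.
  split=> X.
    move=> h; have [fS fSE] := uex X (fun i => h (inl i)).
    have ex_t x : exists t : {linear X x -> M x},
        (forall d : D x, t =1 h (inr (exist _ x d))) /\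
        (~ D x -> t =1 res_out S x \o fS x).
      have [d|nd] := pselect (D x).
        by exists (h (inr (exist _ x d))); split=> // d'; rewrite (Prop_irrelevance d' d).
      by exists (res_out S x \o fS x); split.
    have [t tE] := dchoice ex_t.
    (* [F1] takes the failure of [t] to commute with the arrows into [D] as its cogenerator values;
       the twist adds it back. *)
    have [F1 F1E] := wex X (fun i => let al := projT2 (projT2 (sval i)) in
      (t _ \o rep_map X al) \- (rep_map M al \o t _)).
    have lF x : linear (fun v => (F1 x v, t x v) : (J1 x * M x)%type).
      by move=> r p q; rewrite !linearP.
    have F_nat x y (al : arrow x y) v :
        lmap (lF y) (rep_map X al v) = rep_map E al (lmap (lF x) v).
      rewrite [RHS]E_map /= hom_natural; congr pair.
      suff -> : extend0 w al (F1 x v) = t y (rep_map X al v) - rep_map M al (t x v).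
        by rewrite addrC subrK.
      have [Dy|nDy] := pselect (D y).
        have Pal : P (pack al) by [].
        by rewrite (extend0E w Pal); exact: (F1E (exist _ _ Pal) v).
      rewrite extend0F // (tE y).2 //= hom_natural mapE.
      have [Dx|nDx] := pselect (D x).
        rewrite (restr0 (fS x v)); last by have [] := Dx.
        by rewrite !linear0 closed // subrr.
      by rewrite (tE x).2 //= outK // subrr.
    exists (@RepHom _ _ X E _ F_nat) => -[i|[x Dx]] v /=; last exact: (tE x).1.
    rewrite -fSE; congr (u i _).
    have [Di|nDi] := pselect (D (a i)); last by rewrite (tE (a i)).2 //= res_outK.
    by rewrite [LHS]restr0 1?[RHS]restr0 //; have [] := Di.
  move=> F G FG.
  (* The [M]-component of a morphism into [E] is natural after restriction to [S], as the twist
     affects only arrows ending in [D]. *)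
  have s_nat (H : rep_hom X E) x y (al : arrow x y) v :
      (res_in S y \o (lmap (@snd_is_linear _ (J1 y) (M y)) \o H y)) (rep_map X al v)
      = rep_map (restr S M) al
          ((res_in S x \o (lmap (@snd_is_linear _ (J1 x) (M x)) \o H x)) v).
    have [Sy|nSy] := pselect (sub_vertex S y); last by rewrite [LHS]restr0 // [RHS]restr0.
    have nDy : ~ D y by case.
    rewrite mapE /= hom_natural; congr (res_in S y _).
    rewrite (surjective_pairing (H x v)) E_map /= extend0F // addr0.
    have [Dx|nDx] := pselect (D x); first by rewrite !closed.
    by rewrite outK.
  have FGr x v : (F x v).2 = (G x v).2.
    have [Dx|nDx] := pselect (D x); first exact: (FG (inr (exist _ x Dx))).
    rewrite -(outK (F x v).2 nDx) -(outK (G x v).2 nDx); congr (res_out S x _).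
    apply: (uun X (@RepHom _ _ X (restr S M) _ (s_nat F))
      (@RepHom _ _ X (restr S M) _ (s_nat G))) => i m; exact: (FG (inl i)).
  have FGl x v : (F x v).1 = (G x v).1.
    apply: (wun X (hom_comp g F) (hom_comp g G)) => -[[y [z al]] Pal] m /=.
    (* The cogenerators of [J1] see the first component as the failure of the second to be natural,
       so the second determines the first. *)
    have defect (H : rep_hom X E) : w (exist _ (pack al) Pal) (H y m).1
        = (H z (rep_map X al m)).2 - rep_map M al (H y m).2.
      rewrite hom_natural (surjective_pairing (H y m)) E_map /= (extend0E w Pal).
      by rewrite [RHS]addrC addKr.
    by rewrite !defect !FGr.
  by move=> x v; rewrite (surjective_pairing (F x v)) FGl FGr -surjective_pairing.
- exact: (cofree_in_Inj hQ.2 (u := w) Pfin wcofree).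
- move=> x; split=> [m m' []//|[xi m]|xi]; last by exists (xi, 0).
  by split=> [/= ->|[m' [<- _]]//]; exists m.
Qed.

End Extension.
End Main.

Theorem theorem1p12 (Q : quiver) (k : fieldType)
    (hQ : strongly_locally_finite Q) (M : rep Q k) :
  (almost_fin_presented M <->
     exists S : subquiver Q,
       [/\ is_subquiver S (supp M), cofinite S (supp M),
           successor_closed S (supp M) & projective_on S M])
  /\
  (almost_fin_copresented M <->
     exists S : subquiver Q,
       [/\ is_subquiver S (supp M), cofinite S (supp M),
           predecessor_closed S (supp M) & injective_on S M]).
Proof.
split; split.
- exact: presented_projective.
- by move=> [S [SM Scof Scl MS]]; exact: (projective_presented hQ SM Scof).
- exact: copresented_injective.
- by move=> [S [SM Scof Scl MS]]; exact: (injective_copresented hQ SM Scof).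
Qed.
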